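(* For any integer $\ell \geq 1$, \begin{align*} S(\overline{2}, \{1\}_{2\ell-1},1) = {} & 2 \zeta(\overline{2\ell+1},1) + 2^{-1-2\ell} \zeta(2\ell+2) + \big(2^{1-2\ell} - 4 \big) \log(2) \zeta(2\ell+1) \\ & + \sum_{\substack{r + 2k = 2\ell-1 \\ r,k \geq 0}} 4 \log(2) \beta(r+1) \frac{(-1)^k}{(2k+1)!} \Big( \frac{\pi}{2} \Big)^{2k+1} \\ & + \sum_{\substack{p+q=2\ell+2 \\ p, q \geq 2}} (-1)^p (1 - 2^{1-p}) (3 - 2^{1-q}) \zeta(p) \zeta(q) \\ & + \sum_{\substack{r + 2k = 2\ell \\ k, r \geq 0}} 2 \beta(r+1) \, \frac{(-1)^{k+1}}{(2k+1)!} \Big( \frac{\pi}{2} \Big)^{2k+1} + \sum_{\substack{p+r= 2\ell \\ p, r \geq 0}} 2 (-1)^p \beta(r+1) \beta(p+1) \\ & + \sum_{\substack{p + r + 2k = 2\ell-1 \\ p \geq 1 ,\, r, k \geq 0}} 4 (-1)^{p+k} \beta(r+1) \, (1 - 2^{-p}) \zeta(p+1) \, \frac{1}{(2k+1)!} \Big( \frac{\pi}{2} \Big)^{2k+1} . \end{align*}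
   Context: $\zeta$ is the Riemann zeta function and $\beta(s)=\sum_{n\ge1}(-1)^{n-1}(2n-1)^{-s}$ is the Dirichlet beta function. For integers $a,b\ge1$, $\zeta(\overline a,b)=\sum_{n>m>0}\frac{(-1)^n}{n^am^b}$. $\{1\}_n$ denotes $1$ repeated $n$ times. The multiple $S$ value in question is $$S(\overline2,\{1\}_{2\ell-1},1)=S(\overline2,\{1\}_{2\ell})=2^{2\ell+1}\sum_{\substack{n_1>n_2>\cdots>n_{2\ell+1}>0\\ n_1,n_3,\ldots,n_{2\ell+1}\text{ even}\\ n_2,n_4,\ldots,n_{2\ell}\text{ odd}}}\frac{(-1)^{n_1/2}}{n_1^2n_2\cdots n_{2\ell+1}}.$$ *)

(* Defs.v *)
From Stdlib Require Import Reals.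
From Coquelicot Require Import Coquelicot.
From mathcomp Require Import all_boot.

Set Implicit Arguments.
Unset Strict Implicit.
Unset Printing Implicit Defensive.

Local Open Scope R_scope.

Notation "\sum_ ( i < n ) F" := (\big[Rplus/R0]_(i < n) F) : R_scope.
Notation "\sum_ ( i < n | P ) F" := (\big[Rplus/R0]_(i < n | P) F) : R_scope.
Notation "\sum_ ( i : t | P ) F" := (\big[Rplus/R0]_(i : t | P) F) : R_scope.
Notation "\sum_ ( m <= i < n ) F" := (\big[Rplus/R0]_(m <= i < n) F) : R_scope.
Notation "\prod_ ( i < n ) F" := (\big[Rmult/R1]_(i < n) F) : R_scope.

(* [Series] sums from index 0, hence the shifts of index in the three series. *)
Definition zeta (s : nat) : R := Series (fun n => / INR n.+1 ^ s).

(* For s = 1 the series converges only conditionally; [Series] is the limit of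
   the partial sums in the natural order. *)
Definition beta (s : nat) : R :=
  Series (fun n => (-1) ^ n / INR (2 * n + 1) ^ s).

Definition zeta_bar (a b : nat) : R :=
  Series (fun n => (-1) ^ n.+1 / INR n.+1 ^ a *
                   \sum_(1 <= m < n.+1) / INR m ^ b).

(* The summation variables n_1, ..., n_(2l+1) are n 0, ..., n (2l): the parity
   condition "n_1, n_3, ... even and n_2, n_4, ... odd" says that each n i has
   the parity of its 0-based index i. *)
Definition S_index (l N : nat) (n : {ffun 'I_(2 * l).+1 -> 'I_N}) : bool :=
  [&& [forall i : 'I_(2 * l).+1, forall j : 'I_(2 * l).+1, (i < j)%N ==> (n j < n i)%N],
      [forall i : 'I_(2 * l).+1, (0 < n i)%N] &
      [forall i : 'I_(2 * l).+1, odd (n i) == odd i]].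

(* The first variable occurs squared in the denominator: once through the
   product, once separately. *)
Definition S_term (l N : nat) (n : {ffun 'I_(2 * l).+1 -> 'I_N}) : R :=
  (-1) ^ (n ord0)./2 / (INR (n ord0) * \prod_(i < (2 * l).+1) INR (n i)).

(* S(\bar 2, {1}_(2l)): the infinite sum is the limit of its truncations to
   n_1 < N. *)
Definition S_bar2_ones (l : nat) : R :=
  2 ^ (2 * l).+1 *
  real (Lim_seq (fun N =>
    \sum_(n : {ffun 'I_(2 * l).+1 -> 'I_N} | S_index n) S_term n)).

(* Main.v *)
From HB Require Import structures.
Require Import Defs.
From Stdlib Require Import Reals Lra Lia.
From Coquelicot Require Import Coquelicot.
From mathcomp Require Import all_boot.
From mathcomp Require Import zify.

(** Put a = 2l+1, eta s = sum_n (-1)^(n-1) / n^s (so that eta 1 = log 2),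
    lambda s = the sum of 1/n^s over odd n, and t = tan (x/2) for x in
    [0, pi/2].

    Summation over chains of alternating parities is iterated integration. Let
    [chain_poly d] be the (truncated) generating polynomial of the sums over
    the d inner variables, with argument t. Because dt/dx = (1 + t^2) / 2, one
    has d/dx chain_poly (d+1) = (-1)^d chain_poly d up to a truncation error,
    and chain_poly 0 tends to 2 log cos (x/2). On the other hand
    2 log cos (x/2) has the Fourier series 2 sum_n (-1)^(n-1) (cos nx - 1) / n,
    whose iterated primitives vanishing at 0 are series of Taylor remainders of
    sine and cosine, [fourier_sum]. Both sequences obey the same differential
    recursion, so they remain uniformly close, even after division by sin x
    ([chain_fourier]). As dt/t = dx / sin x, S is the integral of
    chain_poly (2l) / sin x, hence the limit of the integrals of
    fourier_sum (2l) / sin x ([S_bar2_ones_lim]).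

    These integrals are explicit. That of (1 - cos nx) / sin x is a sum of
    harmonic type, [cos_quot_int]. That of x^(2i) / sin x is found by
    integrating x^j against the sum of the sin (2j+1)x or cos (2j+1)x by parts
    and applying the Riemann-Lebesgue lemma to x / sin x: if U_M is the sum of
    beta (r+1) (-1)^k (pi/2)^(2k+1) / (2k+1)! over r + 2k = M, then
    U_M = lambda (M+2) for even M, while for odd M the difference
    lambda (M+2) - U_M is, up to sign and a factorial, half of the integral
    ([beta_pi_sum_even], [beta_pi_sum_odd]).

    There remains the series of (-1)^n cos_quot_int n / n^a. From the identity
    sum_(p < a) (-1)^p x^-(a-p) y^-(p+1) = (x^-a + y^-a) / (x + y) for odd a,
    the alternating convolutions sum_p (-1)^p beta (a-p) beta (p+1) and
    sum_p (-1)^p eta (a-p) eta (p+1) become single series weighted by tails of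
    the alternating harmonic series, and a linear combination of these two
    series, zeta_bar a 1, eta (a+1) and log 2 eta a agrees with the series in
    question term by term ([cos_quot_series_lim]).

    Altogether S is a combination of these quantities and of the products
    eta (a-2i) (lambda (2i+1) - U_(2i-1)) ([S_bar2_onesE]). The stated
    formula is a regrouping of this: its terms with powers of pi are the U_M,
    those with M even being lambda values, and the remaining products of two
    zeta values combine by (3 - 2^(1-q)) zeta q = 4 lambda q - eta q. *)

Local Open Scope R_scope.

(** * Finite sums, limits and derivatives *)

HB.instance Definition _ :=
  Monoid.isComLaw.Build R R0 Rplus
    (fun x y z => esym (Rplus_assoc x y z)) Rplus_comm Rplus_0_l.
HB.instance Definition _ :=
  Monoid.isComLaw.Build R R1 Rmult
    (fun x y z => esym (Rmult_assoc x y z)) Rmult_comm Rmult_1_l.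
HB.instance Definition _ := Monoid.isMulLaw.Build R R0 Rmult Rmult_0_l Rmult_0_r.
HB.instance Definition _ :=
  Monoid.isAddLaw.Build R Rmult Rplus Rmult_plus_distr_r Rmult_plus_distr_l.

Lemma INRD m n : INR (m + n)%N = INR m + INR n.
Proof. exact: plus_INR. Qed.

Lemma INRM m n : INR (m * n)%N = INR m * INR n.
Proof. exact: mult_INR. Qed.

Lemma INR_leq {m n} : (m <= n)%N -> INR m <= INR n.
Proof. by move=> /leP; exact: le_INR. Qed.

Lemma INR_ltn {m n} : (m < n)%N -> INR m < INR n.
Proof. by move=> /ltP; exact: lt_INR. Qed.

Lemma INR_gt0 {n} : (0 < n)%N -> 0 < INR n.
Proof. exact: INR_ltn. Qed.

Lemma INR_neq0 {n} : (0 < n)%N -> INR n <> 0.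
Proof. by move=> /INR_gt0; lra. Qed.

Lemma sum_nE (f : nat -> R) n : sum_n f n = \sum_(i < n.+1) f i.
Proof.
elim: n => [|n IH]; first by rewrite sum_O big_ord_recr big_ord0 /= Rplus_0_l.
by rewrite sum_Sn big_ord_recr IH.
Qed.

Lemma sumR_scal (I : finType) (P : pred I) c (F : I -> R) :
  c * \big[Rplus/R0]_(i | P i) F i = \big[Rplus/R0]_(i | P i) (c * F i).
Proof. exact: big_distrr. Qed.

Lemma sumR_add (I : finType) (P : pred I) (F G : I -> R) :
  \big[Rplus/R0]_(i | P i) F i + \big[Rplus/R0]_(i | P i) G i
  = \big[Rplus/R0]_(i | P i) (F i + G i).
Proof. by rewrite big_split. Qed.

Lemma sumR_opp (I : finType) (P : pred I) (F : I -> R) :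
  - (\big[Rplus/R0]_(i | P i) F i) = \big[Rplus/R0]_(i | P i) (- F i).
Proof.
exact: (big_morph Ropp Ropp_plus_distr Ropp_0).
Qed.

Lemma sumR_sub (I : finType) (P : pred I) (F G : I -> R) :
  \big[Rplus/R0]_(i | P i) F i - \big[Rplus/R0]_(i | P i) G i
  = \big[Rplus/R0]_(i | P i) (F i - G i).
Proof. by rewrite /Rminus sumR_opp sumR_add. Qed.

Lemma sumR_le (I : finType) (P : pred I) (F G : I -> R) :
  (forall i, P i -> F i <= G i) ->
  \big[Rplus/R0]_(i | P i) F i <= \big[Rplus/R0]_(i | P i) G i.
Proof.
move=> H; apply: (big_ind2 Rle) => //; first exact: Rle_refl.
by move=> x1 x2 y1 y2; exact: Rplus_le_compat.
Qed.

Lemma sumR_ge0 (I : finType) (P : pred I) (F : I -> R) :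
  (forall i, P i -> 0 <= F i) -> 0 <= \big[Rplus/R0]_(i | P i) F i.
Proof.
move=> H; apply: (big_ind (Rle 0)) => //; first exact: Rle_refl.
exact: Rplus_le_le_0_compat.
Qed.

Lemma sumR_abs (I : finType) (P : pred I) (F : I -> R) :
  Rabs (\big[Rplus/R0]_(i | P i) F i) <= \big[Rplus/R0]_(i | P i) Rabs (F i).
Proof.
apply: (big_ind2 (fun x y => Rabs x <= y)) => [|x1 x2 y1 y2 H1 H2|i _].
- by rewrite Rabs_R0; exact: Rle_refl.
- by apply: Rle_trans (Rabs_triang _ _) _; exact: Rplus_le_compat.
- exact: Rle_refl.
Qed.

Lemma sumR_const n c : \sum_(i < n) c = INR n * c.
Proof.
elim: n => [|n IH]; first by rewrite big_ord0 /= Rmult_0_l.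
by rewrite big_ord_recr IH S_INR /=; ring.
Qed.

Lemma is_derive_sumR (I : finType) (P : pred I) (F : I -> R -> R) (dF : I -> R) x :
  (forall i, P i -> is_derive (F i) x (dF i)) ->
  is_derive (fun y => \big[Rplus/R0]_(i | P i) F i y) x
    (\big[Rplus/R0]_(i | P i) dF i).
Proof.
move=> H; elim: (index_enum I) => [|i r IH].
  rewrite big_nil; apply: (is_derive_ext (fun=> 0)) => [t|].
    by rewrite big_nil.
  exact: is_derive_const.
rewrite big_cons; case: ifP => Pi; last first.
  by apply: is_derive_ext IH => t; rewrite big_cons Pi.
apply: (is_derive_ext (fun y => plus (F i y) (\big[Rplus/R0]_(i <- r | P i) F i y))).
  by move=> t; rewrite big_cons Pi.
by apply: is_derive_plus => //; exact: H.
Qed.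

Lemma is_RInt_zero a b : is_RInt (fun=> 0) a b 0.
Proof.
have := @is_RInt_const R_NormedModule a b 0.
by rewrite /scal /= /mult /= Rmult_0_r.
Qed.

Lemma is_RInt_sumR (I : finType) (P : pred I) (F : I -> R -> R) (v : I -> R) a b :
  (forall i, P i -> is_RInt (F i) a b (v i)) ->
  is_RInt (fun y => \big[Rplus/R0]_(i | P i) F i y) a b
    (\big[Rplus/R0]_(i | P i) v i).
Proof.
move=> H; elim: (index_enum I) => [|i r IH].
  rewrite big_nil; apply: (is_RInt_ext (fun=> 0)) => [t _|].
    by rewrite big_nil.
  exact: is_RInt_zero.
rewrite big_cons; case: ifP => Pi; last first.
  by apply: is_RInt_ext IH => t _; rewrite big_cons Pi.
apply: (is_RInt_ext (fun y => plus (F i y) (\big[Rplus/R0]_(i <- r | P i) F i y))).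
  by move=> t _; rewrite big_cons Pi.
by apply: (@is_RInt_plus R_NormedModule) => //; exact: H.
Qed.

Lemma is_lim_seq_sumR (I : finType) (P : pred I) (u : I -> nat -> R) (v : I -> R) :
  (forall i, P i -> is_lim_seq (u i) (v i)) ->
  is_lim_seq (fun n => \big[Rplus/R0]_(i | P i) u i n)
    (\big[Rplus/R0]_(i | P i) v i).
Proof.
move=> H; elim: (index_enum I) => [|i r IH].
  rewrite big_nil; apply: (is_lim_seq_ext (fun=> 0)) => [t|].
    by rewrite big_nil.
  exact: is_lim_seq_const.
rewrite big_cons; case: ifP => Pi; last first.
  by apply: is_lim_seq_ext IH => t; rewrite big_cons Pi.
apply: (is_lim_seq_ext (fun n => u i n + \big[Rplus/R0]_(i <- r | P i) u i n)).
  by move=> t; rewrite big_cons Pi.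
by apply: is_lim_seq_plus' => //; exact: H.
Qed.

Lemma is_derive_eq (f : R -> R) (x l1 l2 : R) :
  l1 = l2 -> is_derive f x l1 -> is_derive f x l2.
Proof. by move=> ->. Qed.

Lemma is_lim_seq_scalR (u : nat -> R) (a v : R) :
  is_lim_seq u v -> is_lim_seq (fun n => a * u n) (a * v).
Proof. exact: (is_lim_seq_scal_l u a v). Qed.

(** * Chains of alternating parities *)

(** [chain_sum d n] is the sum of 1/(m_1 ... m_d) over the chains
    n > m_1 > ... > m_d > 0 of alternating parities that end in an even m_d. *)
Fixpoint chain_sum (d n : nat) : R :=
  if d is d'.+1 then
    \big[Rplus/R0]_(m < n | (0 < m)%N && (odd m == odd d')) (chain_sum d' m / INR m)
  else 1.

(** The chains of length [k] below [top], as functions into a larger 'I_N: the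
    condition on parities is the one that makes the last value even. *)
Definition chain_index {k N : nat} (top : nat) (f : {ffun 'I_k -> 'I_N}) : bool :=
  [&& [forall i : 'I_k, forall j : 'I_k, (i < j)%N ==> (f j < f i)%N],
      [forall i : 'I_k, (0 < f i < top)%N] &
      [forall i : 'I_k, odd (f i) == odd (k + i).+1]].

(** The chain with first value [p.1] and remaining values [p.2]. *)
Definition ffun_cons {k N : nat} (p : 'I_N * {ffun 'I_k -> 'I_N}) :
  {ffun 'I_k.+1 -> 'I_N} :=
  [ffun i => if unlift ord0 i is Some j then p.2 j else p.1].

Lemma ffun_cons0 k N (p : 'I_N * {ffun 'I_k -> 'I_N}) : ffun_cons p ord0 = p.1.
Proof. by rewrite ffunE unlift_none. Qed.

Lemma ffun_consS k N (p : 'I_N * {ffun 'I_k -> 'I_N}) j :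
  ffun_cons p (lift ord0 j) = p.2 j.
Proof. by rewrite ffunE liftK. Qed.

Lemma ffun_cons_bij k N : bijective (@ffun_cons k N).
Proof.
exists (fun f : {ffun 'I_k.+1 -> 'I_N} => (f ord0, [ffun j : 'I_k => f (lift ord0 j)])) => [[m g]|f].
  rewrite ffun_cons0; congr pair; apply/ffunP => j.
  by rewrite ffunE ffun_consS.
apply/ffunP => i; case: (unliftP ord0 i) => [j|] ->.
  by rewrite ffun_consS ffunE.
by rewrite ffun_cons0.
Qed.

Lemma chain_index_cons k N top (p : 'I_N * {ffun 'I_k -> 'I_N}) :
  chain_index top (ffun_cons p)
  = (0 < p.1 < top)%N && (odd p.1 == odd k) && chain_index p.1 p.2.
Proof.
apply/idP/idP.
  case/and3P => /forallP H1 /forallP H2 /forallP H3.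
  have := H2 ord0; have := H3 ord0; rewrite ffun_cons0 addn0 /= !negbK => -> ->.
  rewrite /=; apply/and3P; split.
  - apply/forallP => i; apply/forallP => j; apply/implyP => ij.
    have /forallP/(_ (lift ord0 j))/implyP := H1 (lift ord0 i).
    by rewrite !ffun_consS !lift0 ltnS; apply.
  - apply/forallP => i.
    have := H2 (lift ord0 i); rewrite ffun_consS => /andP[-> _].
    have /forallP/(_ (lift ord0 i))/implyP := H1 ord0.
    by rewrite ffun_consS ffun_cons0; apply.
  - apply/forallP => i.
    by have := H3 (lift ord0 i); rewrite ffun_consS lift0 addSn addnS /= negbK.
move=> /andP[/andP[/andP[p0 pt] po]] /and3P[/forallP H1 /forallP H2 /forallP H3].
apply/and3P; split.
- apply/forallP => i; apply/forallP => j; apply/implyP.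
  case: (unliftP ord0 i) => [i'|] ->; case: (unliftP ord0 j) => [j'|] -> //.
    rewrite !ffun_consS !lift0 ltnS => ij.
    by have /forallP/(_ j')/implyP := H1 i'; apply.
  by move=> _; rewrite ffun_consS ffun_cons0; have /andP[] := H2 j'.
- apply/forallP => i; case: (unliftP ord0 i) => [i'|] ->.
    rewrite ffun_consS; have /andP[-> /=] := H2 i'.
    by move=> h; exact: ltn_trans h pt.
  by rewrite ffun_cons0 p0.
- apply/forallP => i; case: (unliftP ord0 i) => [i'|] ->.
    by rewrite ffun_consS lift0 addSn addnS /= negbK.
  by rewrite ffun_cons0 addn0 /= negbK.
Qed.

(** Summing out all the variables of a chain but the first; the weight [w] of
    the first variable is arbitrary. *)
Lemma chain_sum_head (w : nat -> R) k N top : (top <= N)%N ->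
  (forall m, (m < N)%N ->
    \big[Rplus/R0]_(g : {ffun 'I_k -> 'I_N} | chain_index m g)
       \prod_(i < k) / INR (g i) = chain_sum k m) ->
  \big[Rplus/R0]_(f : {ffun 'I_k.+1 -> 'I_N} | chain_index top f)
     (w (f ord0) * \prod_(i < k.+1) / INR (f i))
  = \big[Rplus/R0]_(m < top | (0 < m)%N && (odd m == odd k))
     (w m * (chain_sum k m / INR m)).
Proof.
move=> topN H.
rewrite (reindex (@ffun_cons k N)); last first.
  by apply: onW_bij; exact: ffun_cons_bij.
transitivity (\big[Rplus/R0]_(i : 'I_N | (0 < i < top)%N && (odd i == odd k))
   \big[Rplus/R0]_(g : {ffun 'I_k -> 'I_N} | chain_index i g)
      (w i * (/ INR i * \prod_(j < k) / INR (g j)))).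
  rewrite pair_big_dep /=; apply: eq_big => [p|p _].
    by rewrite chain_index_cons.
  rewrite ffun_cons0 big_ord_recl ffun_cons0; congr (_ * (_ * _)).
  by apply: eq_bigr => j _; rewrite ffun_consS.
rewrite (big_ord_widen_cond N (fun m => (0 < m)%N && (odd m == odd k))
  (fun m => w m * (chain_sum k m / INR m))) //.
apply: eq_big => [i|i _].
  by rewrite -!andbA; congr andb; rewrite andbC.
rewrite -(H _ (ltn_ord i)) /Rdiv.
by rewrite [X in w _ * X]Rmult_comm sumR_scal sumR_scal.
Qed.

Lemma chain_sumE k N top : (top <= N)%N ->
  \big[Rplus/R0]_(f : {ffun 'I_k -> 'I_N} | chain_index top f)
     \prod_(i < k) / INR (f i) = chain_sum k top.
Proof.
elim: k top => [|k IH] top topN.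
  rewrite (big_pred1 (@ffun0 _ (fun=> 'I_N) (card_ord 0))) ?big_ord0 // => f.
  rewrite /chain_index; apply/idP/idP => _.
    by apply/eqP/ffunP => -[].
  by apply/and3P; split; apply/forallP => -[].
under eq_bigr => f _ do rewrite -[\prod_(i < _) _]Rmult_1_l.
rewrite (chain_sum_head (fun=> 1)) => //; last first.
  by move=> m mN; apply: IH; exact: ltnW.
by apply: eq_bigr => m _; rewrite Rmult_1_l.
Qed.

Lemma S_truncE l N :
  \big[Rplus/R0]_(n : {ffun 'I_(2 * l).+1 -> 'I_N} | S_index n) S_term n
  = \big[Rplus/R0]_(m < N | (0 < m)%N && ~~ odd m)
      ((-1) ^ m./2 * chain_sum (2 * l) m / INR m ^ 2).
Proof.
transitivity (\big[Rplus/R0]_(f : {ffun 'I_(2 * l).+1 -> 'I_N} | chain_index N f)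
     ((fun m : nat => (-1) ^ m./2 / INR m) (f ord0) * \prod_(i < (2 * l).+1) / INR (f i))).
  apply: eq_big => [f|f _].
    rewrite /S_index /chain_index; congr [&& _, _ & _]; apply: eq_forallb => i.
      by rewrite ltn_ord andbT.
    by rewrite addSn /= negbK oddD oddM.
  rewrite /S_term /Rdiv Rinv_mult Rmult_assoc; congr (_ * (_ * _)).
  exact: (big_morph Rinv Rinv_mult Rinv_1).
rewrite (chain_sum_head (fun m => (-1) ^ m./2 / INR m)) => //; last first.
  by move=> m mN; apply: chain_sumE; exact: ltnW.
apply: eq_big => [m|m /andP[m0 _]]; first by rewrite mul2n odd_double eqbF_neg.
have := INR_neq0 m0; move=> h; field; lra.
Qed.

(** * Generating polynomials of the chain sums *)

Lemma chain_sum0 d : chain_sum d.+1 0 = 0.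
Proof. by rewrite /= big_ord0. Qed.

Lemma chain_sum1 d : chain_sum d.+1 1 = 0.
Proof. by rewrite /= big_mkcond big_ord_recr big_ord0 /= Rplus_0_l. Qed.

Lemma chain_sumS d n : chain_sum d.+1 n.+1 = chain_sum d.+1 n +
  (if (0 < n)%N && (odd n == odd d) then chain_sum d n / INR n else 0).
Proof. by rewrite /= big_mkcond big_ord_recr /= -big_mkcond. Qed.

Lemma chain_sum_ge0 d n : 0 <= chain_sum d n.
Proof.
elim: d n => [|d IH] n; first exact: Rle_0_1.
apply: sumR_ge0 => i /andP[i0 _]; apply: Rmult_le_pos => //.
by apply/Rlt_le/Rinv_0_lt_compat/INR_gt0.
Qed.

(** If chain_sum d m / m tends to 0 then so do its arithmetic means, and these
    dominate chain_sum (d+1) n / n. *)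
Lemma chain_sum_sublinear d : is_lim_seq (fun n => chain_sum d n / INR n) 0.
Proof.
elim: d => [|d IH].
  apply: (is_lim_seq_ext (fun n => / INR n)) => [n|]; first by rewrite /Rdiv Rmult_1_l.
  apply: (is_lim_seq_inv _ p_infty) => //; exact: is_lim_seq_INR.
have := Cesaro_1 (fun n => chain_sum d n / INR n) 0.
move=> /(_ (proj1 (is_lim_seq_Reals _ 0) IH)) /is_lim_seq_Reals H.
apply: (is_lim_seq_le_le_loc (fun=> 0) _ _ 0 _ (is_lim_seq_const 0) H).
exists 1%N => n /leP n1.
have n0 := INR_gt0 n1; split.
  apply: Rmult_le_pos; first exact: chain_sum_ge0.
  exact/Rlt_le/Rinv_0_lt_compat.
apply: Rmult_le_compat_r; first exact/Rlt_le/Rinv_0_lt_compat.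
rewrite -sum_n_Reals sum_nE prednK //= big_mkcond; apply: sumR_le => i _.
have ci := chain_sum_ge0 d i.
case: ifP => [_|_]; first exact: Rle_refl.
have [->|i0] := posnP i; last first.
  by apply: Rmult_le_pos => //; apply/Rlt_le/Rinv_0_lt_compat/INR_gt0.
by rewrite /Rdiv /= Rinv_0 Rmult_0_r; exact: Rle_refl.
Qed.

(** The generating polynomials of the chain sums. Up to a power of i, the sign
    (-1)^(n/2) is what the substitution of i t for the variable produces, and
    [chain_coef d n] is n times the coefficient of t^n. *)
Definition chain_coef (d n : nat) : R :=
  if (0 < n)%N && (odd n == odd d) then (-1) ^ n./2 * 2 ^ d.+1 * chain_sum d n
  else 0.

Arguments chain_coef : simpl never.
Arguments INR : simpl never.

Definition chain_poly (d N : nat) (t : R) : R :=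
  \sum_(n < N.+1) (chain_coef d n / INR n * t ^ n).

Lemma chain_coef0 d : chain_coef d 0 = 0.
Proof. by []. Qed.

Lemma chain_coef1 d : chain_coef d.+1 1 = 0.
Proof. by rewrite /chain_coef chain_sum1 Rmult_0_r; case: ifP. Qed.

Lemma pow_m1E d : (-1) ^ d = if odd d then -1 else 1.
Proof. by elim: d => //= d ->; case: odd => /=; ring. Qed.

(** In terms of generating series, this recurrence says that
    (1 + t^2) d/dt chain_poly (d+1) = 2 (-1)^d chain_poly d. *)
Lemma chain_coef_rec d n :
  chain_coef d.+1 n.+2 + chain_coef d.+1 n
  = 2 * (-1) ^ d * (chain_coef d n.+1 / INR n.+1).
Proof.
have [e|ne] := eqVneq (odd n.+1) (odd d); last first.
  have e' : (odd n.+2 == odd d.+1) = false.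
    by apply: negbTE; move: ne; rewrite /=; case: odd; case: odd.
  have e2 : (odd n == odd d.+1) = false by move: e'; rewrite /= negbK.
  by rewrite /chain_coef e' e2 (negbTE ne) !andbF /=; rewrite /Rdiv !Rmult_0_l; ring.
have e2 : odd n = odd d.+1 by move: e; rewrite /= => <-; rewrite negbK.
have -> : chain_coef d.+1 n = (-1) ^ n./2 * 2 ^ d.+2 * chain_sum d.+1 n.
  rewrite /chain_coef e2 eqxx andbT; case: n {e e2} => [|n] //.
  by rewrite chain_sum0 Rmult_0_r.
have h := INR_neq0 (ltn0Sn n).
rewrite /chain_coef (chain_sumS d n.+1) (chain_sumS d n) e e2.
have -> : odd n.+2 == odd d.+1 by rewrite -e2 /= negbK.
have -> : (odd d.+1 == odd d) = false by rewrite /=; case: odd.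
move: (INR n.+1) h (chain_sum d.+1 n) (chain_sum d n.+1) => D h x y.
rewrite andbF eqxx /= uphalf_half e2 /= (pow_m1E d).
by case E: (odd d); rewrite /= ?add1n ?add0n /=; field.
Qed.

(** The same identity for the truncated series; the last two terms are the
    truncation error. *)
Lemma chain_poly_rec d N t :
  \sum_(n < N.+1) (chain_coef d.+1 n * (t ^ n.-1 * (1 + t ^ 2)))
  = 2 * (-1) ^ d * chain_poly d N t
    + (chain_coef d.+1 N * t ^ N.+1 - chain_coef d.+1 N.+1 * t ^ N).
Proof.
elim: N => [|N IH].
  rewrite /chain_poly !big_ord_recr !big_ord0 /= chain_coef0 chain_coef1.
  by rewrite chain_coef0 /Rdiv; ring.
rewrite /chain_poly big_ord_recr IH /chain_poly [in RHS]big_ord_recr /=.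
have -> : chain_coef d.+1 N.+2
  = 2 * (-1) ^ d * (chain_coef d N.+1 / INR N.+1) - chain_coef d.+1 N.
  by rewrite -chain_coef_rec; ring.
by ring.
Qed.

(** At depth 0 the recurrence starts from the series of -2t. *)
Lemma chain_poly_rec0 N t :
  \sum_(n < N.+2) (chain_coef 0 n * (t ^ n.-1 * (1 + t ^ 2)))
  = - 2 * t + (chain_coef 0 N.+1 * t ^ N.+2 - chain_coef 0 N.+2 * t ^ N.+1).
Proof.
have H n : chain_coef 0 n.+3 = - chain_coef 0 n.+1.
  by rewrite /chain_coef /= negbK; case: ifP => _; ring.
have c2 : chain_coef 0 2 = - 2 by rewrite /chain_coef /=; ring.
have c1 : chain_coef 0 1 = 0 by [].
elim: N => [|N IH].
  by rewrite !big_ord_recr !big_ord0 /= c1 c2 chain_coef0; ring.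
by rewrite big_ord_recr IH /= H; ring.
Qed.

Lemma chain_coef_sublinear d : is_lim_seq (fun n => chain_coef d n / INR n) 0.
Proof.
apply/is_lim_seq_abs_0.
have H : is_lim_seq (fun n => 2 ^ d.+1 * (chain_sum d n / INR n)) 0.
  have := is_lim_seq_scal_l _ (2 ^ d.+1) _ (chain_sum_sublinear d).
  by rewrite /= Rmult_0_r.
apply: (is_lim_seq_le_le (fun=> 0) _ _ 0 _ (is_lim_seq_const 0) H) => n.
split; first exact: Rabs_pos.
have c0 := chain_sum_ge0 d n.
have p0 : 0 < 2 ^ d.+1 by apply: pow_lt; lra.
have i0 : 0 <= / INR n.
  case: n {c0} => [|n]; first by rewrite Rinv_0; lra.
  by apply/Rlt_le/Rinv_0_lt_compat/INR_gt0.
rewrite /Rdiv Rabs_mult (Rabs_pos_eq (/ _)) // -Rmult_assoc.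
apply: Rmult_le_compat_r => //; rewrite /chain_coef; case: ifP => _; last first.
  by rewrite Rabs_R0; apply: Rmult_le_pos => //; exact: Rlt_le.
rewrite Rabs_mult Rabs_mult pow_1_abs (Rabs_pos_eq (2 ^ d.+1)); last by apply: Rlt_le.
rewrite Rabs_pos_eq //; lra.
Qed.

(** * The variable t = tan (x/2) and comparison of primitives *)

(** A function that vanishes at 0 and whose derivative is dominated by that of
    a function [g] vanishing at 0 is dominated by [g]. *)
Lemma derive_compare (f df g dg : R -> R) b :
  (forall x, 0 <= x <= b -> is_derive f x (df x)) ->
  (forall x, 0 <= x <= b -> is_derive g x (dg x)) ->
  (forall x, 0 <= x <= b -> Rabs (df x) <= dg x) ->
  f 0 = 0 -> g 0 = 0 ->
  forall x, 0 <= x <= b -> Rabs (f x) <= g x.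
Proof.
move=> Hf Hg Hd f0 g0 x [x0 xb].
have mono (h dh : R -> R) : (forall y, 0 <= y <= b -> is_derive h y (dh y)) ->
    (forall y, 0 <= y <= b -> 0 <= dh y) -> h 0 = 0 -> 0 <= h x.
  move=> Hh Hp h0.
  have xE : Rmin 0 x = 0 /\ Rmax 0 x = x by rewrite Rmin_left // Rmax_right.
  have [||c] := MVT_gen h 0 x dh; rewrite (proj1 xE) (proj2 xE).
  - by move=> y ?; apply: Hh; lra.
  - move=> y ?; apply: derivable_continuous_pt; exists (dh y).
    by apply/is_derive_Reals/Hh; lra.
  - move=> [cx]; rewrite h0 !Rminus_0_r => ->.
    by apply: Rmult_le_pos => //; apply: Hp; lra.
have Hd' y : 0 <= y <= b -> - dg y <= df y <= dg y.
  by move=> /Hd; move=> /Rabs_le_between.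
have h1 : 0 <= minus (g x) (f x).
  apply: (mono (fun y => minus (g y) (f y)) (fun y => minus (dg y) (df y))).
  - by move=> y yb; apply: (@is_derive_minus _ R_NormedModule); [exact: Hg|exact: Hf].
  - by move=> y /Hd'; rewrite /minus /plus /opp /=; lra.
  - by rewrite f0 g0 /minus /plus /opp /=; lra.
have h2 : 0 <= plus (g x) (f x).
  apply: (mono (fun y => plus (g y) (f y)) (fun y => plus (dg y) (df y))).
  - by move=> y yb; apply: (@is_derive_plus _ R_NormedModule); [exact: Hg|exact: Hf].
  - by move=> y /Hd'; rewrite /plus /=; lra.
  - by rewrite f0 g0 /plus /=; lra.
by apply/Rabs_le_between; move: h1 h2; rewrite /minus /plus /opp /=; lra.
Qed.

(** The variable t = tan (x/2), which maps [0, pi/2] onto [0, 1]. *)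
Definition thalf (x : R) : R := tan (x / 2).

Lemma cos_half_gt {x} : 0 <= x <= PI / 2 -> / 2 < cos (x / 2).
Proof.
move=> xr; have p0 := PI_RGT_0.
apply: (Rlt_le_trans _ (cos (PI / 4))); last first.
  by apply: cos_decr_1; lra.
have := cos_PI3; have : cos (PI / 3) < cos (PI / 4) by apply: cos_decreasing_1; lra.
by lra.
Qed.

Lemma thalf_range {x} : 0 <= x <= PI / 2 -> 0 <= thalf x <= 1.
Proof.
move=> xr; have p0 := PI_RGT_0; rewrite /thalf -tan_PI4 -[X in X <= _]tan_0.
split; have [xx|<-] : 0 < x \/ 0 = x by lra.
- by apply: Rlt_le; apply: tan_increasing; lra.
- by rewrite /Rdiv Rmult_0_l; exact: Rle_refl.
- have [yy|->] : x / 2 < PI / 4 \/ x / 2 = PI / 4 by lra.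
    by apply: Rlt_le; apply: tan_increasing; lra.
  exact: Rle_refl.
- by apply: Rlt_le; apply: tan_increasing; lra.
Qed.

Lemma thalf0 : thalf 0 = 0.
Proof. by rewrite /thalf /Rdiv Rmult_0_l tan_0. Qed.

Lemma thalf_PI2 : thalf (PI / 2) = 1.
Proof. by rewrite /thalf -[RHS]tan_PI4; congr tan; lra. Qed.

Lemma is_derive_thalf {x} : 0 <= x <= PI / 2 ->
  is_derive thalf x ((1 + thalf x ^ 2) / 2).
Proof.
move=> xr; have c0 := cos_half_gt xr; rewrite /thalf /tan.
auto_derive; first lra.
by rewrite -/(Rdiv x 2); field; lra.
Qed.

Lemma is_derive_thalf_pow n {x} : 0 <= x <= PI / 2 ->
  is_derive (fun y => thalf y ^ n) x (INR n * (thalf x ^ n.-1 * ((1 + thalf x ^ 2) / 2))).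
Proof.
move=> xr.
apply: is_derive_eq (is_derive_pow _ n _ _ (is_derive_thalf xr)).
by ring.
Qed.

Lemma thalf_pow_range n {x} : 0 <= x <= PI / 2 -> 0 <= thalf x ^ n <= 1.
Proof.
move=> /thalf_range [t0 t1]; split; first exact: pow_le.
by rewrite -(pow1 n); apply: pow_incr.
Qed.

(** One step of the comparison: if [u] and [v] are within [E] of each other,
    then their primitives [U] and [V], the former perturbed by an error of
    order t^n, are within a small multiple of t of each other. *)
Lemma integration_compare (U V u v e : R -> R) E c n :
  0 <= E -> 0 <= c ->
  (forall x, 0 <= x <= PI / 2 -> is_derive U x (u x + e x)) ->
  (forall x, 0 <= x <= PI / 2 -> is_derive V x (v x)) ->
  (forall x, 0 <= x <= PI / 2 -> Rabs (u x - v x) <= E) ->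
  (forall x, 0 <= x <= PI / 2 -> Rabs (e x) <= c * thalf x ^ n) ->
  U 0 = 0 -> V 0 = 0 ->
  forall x, 0 <= x <= PI / 2 ->
    Rabs (U x - V x) <= (2 * E + 2 * c / INR n.+1) * thalf x.
Proof.
move=> E0 c0 HU HV Huv He U0 V0 x xr.
have n0 := INR_gt0 (ltn0Sn n).
apply: (Rle_trans _ (2 * E * thalf x + 2 * c / INR n.+1 * thalf x ^ n.+1)).
  apply: (derive_compare (fun y => minus (U y) (V y)) (fun y => minus (u y + e y) (v y))
    (fun y => 2 * E * thalf y + 2 * c / INR n.+1 * thalf y ^ n.+1)
    (fun y => 2 * E * ((1 + thalf y ^ 2) / 2)
       + 2 * c / INR n.+1 * (INR n.+1 * (thalf y ^ n * ((1 + thalf y ^ 2) / 2)))))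
    xr.
  - move=> y yr; apply: (@is_derive_minus _ R_NormedModule); [exact: HU|exact: HV].
  - move=> y yr; apply: (@is_derive_plus _ R_NormedModule).
      by apply: is_derive_scal; exact: is_derive_thalf.
    by apply: is_derive_scal; exact: is_derive_thalf_pow.
  - move=> y yr; have := Huv _ yr; have := He _ yr.
    have := thalf_pow_range n yr; have := thalf_pow_range 2 yr.
    move: (thalf y ^ 2) (thalf y ^ n) => s t s0 t0 h1 h2.
    apply: (Rle_trans _ (E + c * t)).
      rewrite (_ : minus _ _ = (u y - v y) + e y); last first.
        by rewrite /minus /plus /opp /=; ring.
      by apply: Rle_trans (Rabs_triang _ _) _; lra.
    rewrite [X in _ <= X](_ : _ = E + c * t + (E * s + c * t * s)); last first.
      by field; lra.
    have : 0 <= E * s + c * t * s; last by lra.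
    by apply: Rplus_le_le_0_compat; repeat apply: Rmult_le_pos; lra.
  - by rewrite U0 V0 /minus /plus /opp /=; ring.
  - by rewrite thalf0 /= Rmult_0_l !Rmult_0_r; ring.
rewrite Rmult_plus_distr_r; apply: Rplus_le_compat_l.
apply: Rmult_le_compat_l.
  by apply: Rmult_le_pos; [lra|exact/Rlt_le/Rinv_0_lt_compat].
have [t0 _] := thalf_range xr.
rewrite -[X in _ <= X]Rmult_1_r /=; apply: Rmult_le_compat_l => //.
by have [] := thalf_pow_range n xr.
Qed.

Lemma is_derive_chain_poly d N {x} : 0 <= x <= PI / 2 ->
  is_derive (fun y => chain_poly d.+1 N (thalf y)) x
   ((-1) ^ d * chain_poly d N (thalf x)
    + (chain_coef d.+1 N * thalf x ^ N.+1 - chain_coef d.+1 N.+1 * thalf x ^ N) / 2).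
Proof.
move=> xr.
apply: (is_derive_eq _ _ (\sum_(n < N.+1) (chain_coef d.+1 n / INR n *
   (INR n * (thalf x ^ n.-1 * ((1 + thalf x ^ 2) / 2)))))).
  transitivity ((\sum_(n < N.+1) (chain_coef d.+1 n * (thalf x ^ n.-1 * (1 + thalf x ^ 2)))) / 2).
    symmetry; rewrite [LHS]Rmult_comm sumR_scal; apply: eq_bigr => -[[|n] ?] _ /=.
      by rewrite chain_coef0 /Rdiv; ring.
    by field; apply: INR_neq0.
  by rewrite chain_poly_rec; field.
apply: is_derive_sumR => n _; apply: is_derive_scal.
exact: (is_derive_thalf_pow n xr).
Qed.

Lemma is_derive_chain_poly0 N {x} : 0 <= x <= PI / 2 ->
  is_derive (fun y => chain_poly 0 N.+1 (thalf y)) x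
   (- thalf x
    + (chain_coef 0 N.+1 * thalf x ^ N.+2 - chain_coef 0 N.+2 * thalf x ^ N.+1) / 2).
Proof.
move=> xr.
apply: (is_derive_eq _ _ (\sum_(n < N.+2) (chain_coef 0 n / INR n *
   (INR n * (thalf x ^ n.-1 * ((1 + thalf x ^ 2) / 2)))))).
  transitivity ((\sum_(n < N.+2) (chain_coef 0 n * (thalf x ^ n.-1 * (1 + thalf x ^ 2)))) / 2).
    symmetry; rewrite [LHS]Rmult_comm sumR_scal; apply: eq_bigr => -[[|n] ?] _ /=.
      by rewrite chain_coef0 /Rdiv; ring.
    by field; apply: INR_neq0.
  by rewrite chain_poly_rec0; field.
apply: is_derive_sumR => n _; apply: is_derive_scal.
exact: (is_derive_thalf_pow n xr).
Qed.

Lemma chain_poly0 d N : chain_poly d N 0 = 0.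
Proof.
rewrite /chain_poly; apply: big1 => -[[|n] ?] _ /=; last by rewrite Rmult_0_l Rmult_0_r.
by rewrite chain_coef0 /Rdiv !Rmult_0_l.
Qed.

(** * Taylor remainders and the Fourier series of 2 log cos (x/2) *)

(** [cos_rem m] and [sin_rem m] are cos and sin minus their Taylor polynomials
    at 0 of degree 2m and 2m+1. *)
Definition cos_rem (m : nat) (x : R) : R :=
  cos x - \sum_(i < m.+1) ((-1) ^ i / INR (2 * i)`! * x ^ (2 * i)).

Definition sin_rem (m : nat) (x : R) : R :=
  sin x - \sum_(i < m.+1) ((-1) ^ i / INR (2 * i + 1)`! * x ^ (2 * i + 1)).

Lemma cos_rem_0 m : cos_rem m 0 = 0.
Proof.
rewrite /cos_rem cos_0 big_ord_recl big1 => [|i _]; first by rewrite muln0 fact0 /= /INR; field.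
by rewrite lift0 mulnS /= Rmult_0_l Rmult_0_r.
Qed.

Lemma sin_rem_0 m : sin_rem m 0 = 0.
Proof.
rewrite /sin_rem sin_0 big1 => [|i _]; first by rewrite Rminus_0_r.
by rewrite addn1 /= Rmult_0_l Rmult_0_r.
Qed.

Lemma is_derive_sin_rem m x : is_derive (sin_rem m) x (cos_rem m x).
Proof.
apply: (@is_derive_minus _ R_NormedModule); first exact: is_derive_sin.
apply: is_derive_sumR => i _.
apply: (is_derive_eq _ _
  ((-1) ^ i / INR (2 * i + 1)`! * (INR (2 * i + 1) * 1 * x ^ (2 * i + 1).-1))).
  rewrite addn1 /= factS INRM; have := INR_neq0 (fact_gt0 (2 * i)).
  have := INR_neq0 (ltn0Sn (2 * i)).
  by move=> h1 h2; field; split.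
apply: is_derive_scal; apply: is_derive_pow; exact: is_derive_id.
Qed.

Lemma is_derive_cos_rem0 x : is_derive (cos_rem 0) x (- sin x).
Proof.
apply: (is_derive_ext (fun y => cos y - 1)) => [y|].
  by rewrite /cos_rem big_ord_recr big_ord0 muln0 fact0 /= /INR; field.
by auto_derive => //; ring.
Qed.

Lemma is_derive_cos_remS m x : is_derive (cos_rem m.+1) x (- sin_rem m x).
Proof.
apply: (is_derive_eq _ _ (minus (- sin x)
  (- \sum_(i < m.+1) ((-1) ^ i / INR (2 * i + 1)`! * x ^ (2 * i + 1))))).
  by rewrite /sin_rem /minus /plus /opp /=; ring.
apply: (@is_derive_minus _ R_NormedModule); first exact: is_derive_cos.
apply: (is_derive_ext (fun y => plus 1
  (\sum_(i < m.+1) ((-1) ^ i.+1 / INR (2 * i.+1)`! * y ^ (2 * i.+1))))) => [y|].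
  rewrite [in RHS]big_ord_recl /plus /=; congr (_ + _); first by rewrite muln0 fact0 /= /INR; field.
rewrite -[X in is_derive _ _ X]Rplus_0_l.
apply: (@is_derive_plus _ R_NormedModule); first exact: is_derive_const.
rewrite sumR_opp; apply: is_derive_sumR => i _.
apply: (is_derive_eq _ _
  ((-1) ^ i.+1 / INR (2 * i.+1)`! * (INR (2 * i.+1) * 1 * x ^ (2 * i.+1).-1))).
  rewrite mulnS addn1 add2n /= factS INRM; have := INR_neq0 (fact_gt0 (2 * i).+1).
  have := INR_neq0 (ltn0Sn (2 * i).+1).
  by move=> h1 h2; field; split.
apply: is_derive_scal; apply: is_derive_pow; exact: is_derive_id.
Qed.

(** The two families in one sequence, in which each function is up to sign the
    primitive of the preceding one that vanishes at 0. *)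
Definition trig_rem (d : nat) : R -> R :=
  if odd d then sin_rem d./2 else cos_rem d./2.

Lemma trig_rem_0 d : trig_rem d 0 = 0.
Proof. by rewrite /trig_rem; case: odd; rewrite ?sin_rem_0 ?cos_rem_0. Qed.

Lemma is_derive_trig_rem d x :
  is_derive (trig_rem d.+1) x ((-1) ^ d * trig_rem d x).
Proof.
rewrite /trig_rem pow_m1E /= uphalf_half; case: (odd d) => /=.
  by rewrite add1n; apply: is_derive_eq (is_derive_cos_remS _ _); ring.
by rewrite add0n Rmult_1_l; exact: is_derive_sin_rem.
Qed.

(** The truncated Fourier series of 2 log cos (x/2) and its iterated primitives
    vanishing at 0, with the signs of [is_derive_chain_poly]. *)
Definition fourier_sum (d N : nat) (x : R) : R :=
  2 * \sum_(n < N) ((-1) ^ n / INR n.+1 ^ d.+1 * trig_rem d (INR n.+1 * x)).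

Lemma fourier_sum0 d N : fourier_sum d N 0 = 0.
Proof.
rewrite /fourier_sum big1 ?Rmult_0_r // => n _.
by rewrite Rmult_0_r trig_rem_0 Rmult_0_r.
Qed.

Lemma is_derive_fourier_sum d N x :
  is_derive (fourier_sum d.+1 N) x ((-1) ^ d * fourier_sum d N x).
Proof.
rewrite /fourier_sum.
apply: (is_derive_eq _ _ (2 * \sum_(n < N) ((-1) ^ n / INR n.+1 ^ d.+2 * 
   (INR n.+1 * ((-1) ^ d * trig_rem d (INR n.+1 * x)))))).
  rewrite -Rmult_assoc [_ * 2]Rmult_comm Rmult_assoc; congr (_ * _).
  rewrite sumR_scal; apply: eq_bigr => n _.
  have h := INR_neq0 (ltn0Sn n); have h2 := pow_nonzero _ d.+1 h.
  have -> : INR n.+1 ^ d.+2 = INR n.+1 * INR n.+1 ^ d.+1 by [].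
  by move: (INR n.+1) h h2 => b h h2; field; split.
apply: is_derive_scal; apply: is_derive_sumR => n _; apply: is_derive_scal.
apply: (is_derive_comp (trig_rem d.+1) (fun y => INR n.+1 * y)).
  exact: is_derive_trig_rem.
by auto_derive => //; ring.
Qed.

(** The alternating Dirichlet kernel. *)
Lemma dirichlet_sum N x :
  2 * cos (x / 2) * \sum_(n < N) ((-1) ^ n * sin (INR n.+1 * x))
  = sin (x / 2) - (-1) ^ N * sin ((INR N + / 2) * x).
Proof.
elim: N => [|N IH].
  by rewrite big_ord0 /= /INR Rplus_0_l Rmult_0_r Rmult_1_l (Rmult_comm (/ 2)); rewrite /Rdiv; ring.
rewrite big_ord_recr Rmult_plus_distr_l IH /=.
have -> : (INR N + / 2) * x = INR N.+1 * x - x / 2 by rewrite S_INR; field.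
have -> : (INR N.+1 + / 2) * x = INR N.+1 * x + x / 2 by field.
by rewrite sin_plus sin_minus; ring.
Qed.

Definition logcos (x : R) : R := 2 * ln (cos (x / 2)).

Lemma is_derive_logcos {x} : 0 <= x <= PI / 2 -> is_derive logcos x (- thalf x).
Proof.
move=> xr; have c0 := cos_half_gt xr; rewrite /logcos /thalf /tan.
auto_derive; rewrite -/(Rdiv x 2); first by move=> /=; lra.
by field; lra.
Qed.

Lemma logcos0 : logcos 0 = 0.
Proof. by rewrite /logcos /Rdiv Rmult_0_l cos_0 ln_1 Rmult_0_r. Qed.

Lemma fourier_sum_logcos N {x} : 0 <= x <= PI / 2 ->
  Rabs (fourier_sum 0 N x - logcos x) <= 5 / (INR N + / 2).
Proof.
move=> xr; set M := INR N + / 2.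
have M0 : 0 < M by rewrite /M; have := pos_INR N; lra.
(* The derivative of [fourier_sum 0 N - logcos] is (-1)^N sin(My) / cos(y/2);
   adding [c] cancels it up to a term of order 1/M. *)
pose c y := (-1) ^ N * (cos (M * y) / (M * cos (y / 2))).
have cb y : 0 <= y <= PI / 2 -> Rabs (c y) <= 2 / M.
  move=> yr; have c0 := cos_half_gt yr.
  rewrite /c Rabs_mult pow_1_abs Rmult_1_l /Rdiv Rabs_mult Rinv_mult Rabs_mult.
  rewrite -Rmult_assoc (Rmult_comm _ (Rabs (/ M))) Rmult_assoc Rmult_comm.
  have i0 := Rinv_0_lt_compat _ M0.
  rewrite (Rabs_pos_eq (/ M)); last by lra.
  apply: Rmult_le_compat_r; first lra.
  have ci0 : 0 < / cos (y / 2) by apply: Rinv_0_lt_compat; lra.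
  have ci1 : / cos (y / 2) <= 2.
    apply: (Rle_trans _ (/ (/ 2))); [apply: Rinv_le_contravar; lra| rewrite Rinv_inv; lra].
  rewrite (Rabs_pos_eq (/ cos _)); last by lra.
  have cm : Rabs (cos (M * y)) <= 1.
    by apply: Rabs_le; exact: COS_bound.
  have := Rabs_pos (cos (M * y)).
  move: (Rabs (cos _)) (/ cos _) cm ci0 ci1 => a b *.
  by apply: (Rle_trans _ (1 * b)); [apply: Rmult_le_compat_r; lra|lra].
have H : Rabs (fourier_sum 0 N x - logcos x + c x - c 0) <= / M * x.
  apply: (derive_compare (fun y => fourier_sum 0 N y - logcos y + c y - c 0)
    (fun y => (-1) ^ N * (cos (M * y) * sin (y / 2) / (2 * M * cos (y / 2) ^ 2)))
    (fun y => / M * y) (fun=> / M)) xr.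
  - move=> y yr; have c0 := cos_half_gt yr.
    have df : is_derive (fourier_sum 0 N) y
        (- (thalf y - (-1) ^ N * sin (M * y) / cos (y / 2))).
      have -> : thalf y - (-1) ^ N * sin (M * y) / cos (y / 2)
         = 2 * \sum_(n < N) ((-1) ^ n * sin (INR n.+1 * y)).
        have := dirichlet_sum N y; rewrite -/M => e.
        rewrite /thalf /tan.
        apply: (Rmult_eq_reg_l (cos (y / 2))); last by lra.
        rewrite [RHS](_ : _ = sin (y / 2) - (-1) ^ N * sin (M * y)).
          by field; lra.
        by rewrite -e; ring.
      rewrite Ropp_mult_distr_r; apply: is_derive_scal.
      rewrite sumR_opp; apply: is_derive_sumR => n _.
      apply: (is_derive_eq _ _ ((-1) ^ n / INR n.+1 ^ 1 * (INR n.+1 * (- sin (INR n.+1 * y))))).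
        by have h := INR_neq0 (ltn0Sn n); rewrite pow_1; field.
      apply: is_derive_scal.
      apply: (is_derive_comp (trig_rem 0) (fun y => INR n.+1 * y)).
        exact: is_derive_cos_rem0.
      by auto_derive => //; ring.
    have dl := is_derive_logcos yr.
    have dc : is_derive c y ((-1) ^ N * ((- sin (M * y) / cos (y / 2))
        + cos (M * y) * sin (y / 2) / (2 * M * cos (y / 2) ^ 2))).
      apply: is_derive_scal; auto_derive; rewrite -/(Rdiv y 2).
        by apply: Rmult_integral_contrapositive; split; lra.
      by field; lra.
    apply: (is_derive_eq _ _ (minus (plus (minus
       (- (thalf y - (-1) ^ N * sin (M * y) / cos (y / 2))) (- thalf y))
       ((-1) ^ N * ((- sin (M * y) / cos (y / 2))
        + cos (M * y) * sin (y / 2) / (2 * M * cos (y / 2) ^ 2)))) 0)).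
      rewrite /minus /plus /opp /=; field; lra.
    apply: (@is_derive_minus _ R_NormedModule); last exact: is_derive_const.
    apply: (@is_derive_plus _ R_NormedModule) => //.
    by apply: (@is_derive_minus _ R_NormedModule).
  - by move=> y _; auto_derive => //; ring.
  - move=> y yr; have c0 := cos_half_gt yr; have := cb y yr.
    rewrite /c Rabs_mult pow_1_abs Rmult_1_l => h.
    rewrite Rabs_mult pow_1_abs Rmult_1_l.
    have -> : cos (M * y) * sin (y / 2) / (2 * M * cos (y / 2) ^ 2)
        = cos (M * y) / (M * cos (y / 2)) * (thalf y / 2).
      by rewrite /thalf /tan; field; lra.
    have [t0 t1] := thalf_range yr.
    rewrite Rabs_mult (Rabs_pos_eq (thalf y / 2)); last by lra.
    apply: (Rle_trans _ (2 / M * (1 / 2))); last by right; field; lra.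
    apply: Rmult_le_compat => //; [exact: Rabs_pos|lra|lra].
  - by rewrite fourier_sum0 logcos0; ring.
  - by rewrite Rmult_0_r.
have h1 := cb x xr; have h0 : Rabs (c 0) <= / M.
  rewrite /c Rabs_mult pow_1_abs Rmult_1_l Rmult_0_r /Rdiv Rmult_0_l cos_0 Rmult_1_l Rmult_1_r.
  by rewrite Rabs_pos_eq; [right|exact/Rlt_le/Rinv_0_lt_compat].
have -> : fourier_sum 0 N x - logcos x =
   (fourier_sum 0 N x - logcos x + c x - c 0) + (c 0 - c x) by ring.
apply: Rle_trans (Rabs_triang _ _) _.
have : Rabs (c 0 - c x) <= / M + 2 / M.
  by apply: Rle_trans (Rabs_triang _ _) _; rewrite Rabs_Ropp; lra.
have : / M * x <= / M * 2.
  apply: Rmult_le_compat_l; first exact/Rlt_le/Rinv_0_lt_compat.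
  by have := PI_4; lra.
by lra.
Qed.

(** * Uniform comparison of the two truncated series *)

(** A bound for the truncation error of [chain_poly] after integration. *)
Definition tail_err (d N : nat) : R :=
  Rabs (chain_coef d N.+1 / INR N.+1) + Rabs (chain_coef d N.+2 / INR N.+2).

Lemma tail_err_ge0 d N : 0 <= tail_err d N.
Proof. by apply: Rplus_le_le_0_compat; exact: Rabs_pos. Qed.

Lemma tail_err_lim d : is_lim_seq (tail_err d) 0.
Proof.
have H := proj1 (is_lim_seq_abs_0 _) (chain_coef_sublinear d).
rewrite -(Rplus_0_r 0); apply: is_lim_seq_plus'.
  exact: (proj1 (is_lim_seq_incr_1 _ _) H).
apply: (proj1 (is_lim_seq_incr_1 (fun n => Rabs (chain_coef d n.+1 / INR n.+1)) _)).
exact: (proj1 (is_lim_seq_incr_1 _ _) H).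
Qed.

Lemma tail_bound d N t : 0 <= t <= 1 ->
  Rabs ((chain_coef d N.+1 * t ^ N.+2 - chain_coef d N.+2 * t ^ N.+1) / 2)
  <= INR N.+2 * tail_err d N / 2 * t ^ N.+1.
Proof.
move=> [t0 t1]; have p0 : 0 <= t ^ N.+1 by exact: pow_le.
have n1 := INR_gt0 (ltn0Sn N); have n2 := INR_gt0 (ltn0Sn N.+1).
rewrite /Rdiv Rabs_mult (Rabs_pos_eq (/ 2)); last lra.
rewrite [X in _ <= X](_ : _ = INR N.+2 * tail_err d N * t ^ N.+1 * / 2); last by ring.
apply: Rmult_le_compat_r; first lra.
apply: Rle_trans (Rabs_triang _ _) _.
rewrite Rabs_Ropp Rabs_mult (Rabs_mult _ (t ^ N.+1)) (Rabs_pos_eq (t ^ N.+1)) //.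
rewrite (Rabs_pos_eq (t ^ N.+2)); last exact: pow_le.
rewrite /tail_err /Rdiv Rabs_mult (Rabs_mult (chain_coef d N.+2)).
have i1 := Rinv_0_lt_compat _ n1; have i2 := Rinv_0_lt_compat _ n2.
rewrite (Rabs_pos_eq (/ INR N.+1)) ?(Rabs_pos_eq (/ INR N.+2)); try lra.
have a1 := Rabs_pos (chain_coef d N.+1); have a2 := Rabs_pos (chain_coef d N.+2).
have -> : INR N.+2 * (Rabs (chain_coef d N.+1) * / INR N.+1 +
     Rabs (chain_coef d N.+2) * / INR N.+2) * t ^ N.+1
  = Rabs (chain_coef d N.+1) * (INR N.+2 / INR N.+1) * t ^ N.+1
   + Rabs (chain_coef d N.+2) * t ^ N.+1 by field; lra.
apply: Rplus_le_compat_r; rewrite [X in _ <= X]Rmult_assoc; apply: Rmult_le_compat_l => //.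
rewrite -[X in X <= _]Rmult_1_l.
have tt : t ^ N.+2 <= t ^ N.+1.
  by rewrite /= -[X in _ <= X]Rmult_1_l; apply: Rmult_le_compat_r.
apply: Rmult_le_compat => //; [lra|exact: (pow_le t N.+2)|].
apply: (Rmult_le_reg_r (INR N.+1)) => //.
rewrite Rmult_1_l /Rdiv Rmult_assoc Rinv_l ?Rmult_1_r; last lra.
exact: INR_leq.
Qed.

(** The distance between [chain_poly d N.+1] and [fourier_sum d N], as
    accumulated in [d] integrations. *)
Fixpoint compare_err (d N : nat) : R :=
  if d is d'.+1 then 2 * compare_err d' N + tail_err d N
  else tail_err 0 N + 5 / (INR N + / 2).

Lemma inv_half_gt0 N : 0 < / (INR N + / 2).
Proof. by apply: Rinv_0_lt_compat; have := pos_INR N; lra. Qed.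

Lemma compare_err_ge0 d N : 0 <= compare_err d N.
Proof.
elim: d => [|d IH] /=.
  by have := tail_err_ge0 0 N; have := inv_half_gt0 N; rewrite /Rdiv; lra.
by have := tail_err_ge0 d.+1 N; lra.
Qed.

Lemma compare_err_lim d : is_lim_seq (compare_err d) 0.
Proof.
elim: d => [|d IH].
  rewrite -(Rplus_0_r 0); apply: is_lim_seq_plus'; first exact: tail_err_lim.
  rewrite -(Rmult_0_r 5); apply: (is_lim_seq_scal_l _ 5 0).
  apply: (is_lim_seq_inv _ p_infty) => //.
  apply: (is_lim_seq_plus _ _ p_infty (/ 2)) => //; first exact: is_lim_seq_INR.
  exact: is_lim_seq_const.
have := is_lim_seq_plus' _ _ _ _ (is_lim_seq_scal_l _ 2 0 IH) (tail_err_lim d.+1).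
by rewrite /= Rmult_0_r Rplus_0_r.
Qed.

Lemma chain_logcos N {x} : 0 <= x <= PI / 2 ->
  Rabs (chain_poly 0 N.+1 (thalf x) - logcos x) <= tail_err 0 N * thalf x.
Proof.
move=> xr; have n2 := INR_gt0 (ltn0Sn N.+1); have te := tail_err_ge0 0 N.
have -> : tail_err 0 N = 2 * 0 + 2 * (INR N.+2 * tail_err 0 N / 2) / INR N.+2.
  by field; lra.
apply: (integration_compare _ _ (fun y => - thalf y) (fun y => - thalf y)
   _ 0 (INR N.+2 * tail_err 0 N / 2) N.+1 _ _
   (fun y yr => is_derive_chain_poly0 N yr)
   (fun y yr => is_derive_logcos yr)) => //.
- exact: Rle_refl.
- by apply: Rmult_le_pos; [apply: Rmult_le_pos; lra|lra].
- by move=> y yr; rewrite /Rminus Rplus_opp_r Rabs_R0; exact: Rle_refl.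
- by move=> y yr; apply: tail_bound; exact: thalf_range.
- by rewrite thalf0 chain_poly0.
- exact: logcos0.
Qed.

Lemma chain_fourier0 N {x} : 0 <= x <= PI / 2 ->
  Rabs (chain_poly 0 N.+1 (thalf x) - fourier_sum 0 N x) <= compare_err 0 N.
Proof.
move=> xr; have [t0 t1] := thalf_range xr.
have h1 := chain_logcos N xr; have h2 := fourier_sum_logcos N xr.
have -> : chain_poly 0 N.+1 (thalf x) - fourier_sum 0 N x
 = (chain_poly 0 N.+1 (thalf x) - logcos x) + (- (fourier_sum 0 N x - logcos x)) by ring.
apply: Rle_trans (Rabs_triang _ _) _; rewrite Rabs_Ropp.
apply: Rplus_le_compat => //; apply: Rle_trans h1 _.
rewrite -[X in _ <= X]Rmult_1_r; apply: Rmult_le_compat_l => //.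
exact: tail_err_ge0.
Qed.

(** From depth 1 on, the distance is even bounded by a small multiple of t, so
    that it remains small after division by sin x. *)
Lemma chain_fourier d N {x} : 0 <= x <= PI / 2 ->
  Rabs (chain_poly d.+1 N.+1 (thalf x) - fourier_sum d.+1 N x)
  <= compare_err d.+1 N * thalf x.
Proof.
elim: d x => [|d IH] x xr; rewrite [compare_err _ _]/=.
all: have n2 := INR_gt0 (ltn0Sn N.+1).
  have te := tail_err_ge0 1 N.
  have {1}-> : tail_err 1 N = 2 * (INR N.+2 * tail_err 1 N / 2) / INR N.+2.
    by field; lra.
  apply: (integration_compare _ _ (fun y => (-1) ^ 0 * chain_poly 0 N.+1 (thalf y))
     (fun y => (-1) ^ 0 * fourier_sum 0 N y)
     _ (compare_err 0 N) (INR N.+2 * tail_err 1 N / 2) N.+1 _ _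
     (fun y yr => is_derive_chain_poly 0 N.+1 yr)
     (fun y _ => is_derive_fourier_sum 0 N y)) => //.
  - exact: (compare_err_ge0 0).
  - by apply: Rmult_le_pos; [apply: Rmult_le_pos; lra|lra].
  - move=> y yr; rewrite -Rmult_minus_distr_l Rabs_mult pow_1_abs Rmult_1_l.
    exact: chain_fourier0.
  - by move=> y yr; apply: tail_bound; exact: thalf_range.
  - by rewrite thalf0 chain_poly0.
  - exact: fourier_sum0.
have te := tail_err_ge0 d.+2 N.
have {1}-> : tail_err d.+2 N = 2 * (INR N.+2 * tail_err d.+2 N / 2) / INR N.+2.
  by field; lra.
have ce := compare_err_ge0 d.+1 N.
apply: (integration_compare _ _ (fun y => (-1) ^ d.+1 * chain_poly d.+1 N.+1 (thalf y))
   (fun y => (-1) ^ d.+1 * fourier_sum d.+1 N y)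
   _ (compare_err d.+1 N) (INR N.+2 * tail_err d.+2 N / 2) N.+1 _ _
   (fun y yr => is_derive_chain_poly d.+1 N.+1 yr)
   (fun y _ => is_derive_fourier_sum d.+1 N y)) => //.
- by apply: Rmult_le_pos; [apply: Rmult_le_pos; lra|lra].
- move=> y yr; rewrite -Rmult_minus_distr_l Rabs_mult pow_1_abs Rmult_1_l.
  apply: Rle_trans (IH y yr) _; have [t0 t1] := thalf_range yr.
  by rewrite -[X in _ <= X]Rmult_1_r; apply: Rmult_le_compat_l.
- by move=> y yr; apply: tail_bound; exact: thalf_range.
- by rewrite thalf0 chain_poly0.
- exact: fourier_sum0.
Qed.

(** * The function x / sin x *)

(** sin x / x, extended by 1 at 0, as a power series in x^2. *)
Definition sinc (x : R) : R := PSeries sin_n (x ^ 2).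
Definition dsinc (x : R) : R := PSeries (PS_derive sin_n) (x ^ 2) * (2 * x).

Lemma CV_radius_sin_n : CV_radius sin_n = p_infty.
Proof.
apply: CV_radius_infinite_DAlembert; first exact: sin_no_R0.
by apply/is_lim_seq_Reals; exact: Alembert_sin.
Qed.

Lemma sin_sinc x : sin x = x * sinc x.
Proof.
rewrite /sin; case: (exist_sin (Rsqr x)) => a /= H; congr (_ * _).
apply/esym/is_series_unique; rewrite (_ : x ^ 2 = Rsqr x); last by rewrite /Rsqr; ring.
by apply/is_series_Reals.
Qed.

Lemma is_derive_sinc x : is_derive sinc x (dsinc x).
Proof.
rewrite /dsinc Rmult_comm.
apply: (is_derive_comp (PSeries sin_n) (fun y => y ^ 2)).
  by apply: is_derive_PSeries; rewrite CV_radius_sin_n.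
by auto_derive => //; rewrite /INR /=; ring.
Qed.

Lemma continuous_dsinc x : continuous dsinc x.
Proof.
apply: (@continuous_mult _ R_AbsRing).
  apply: (continuous_comp (fun y => y ^ 2)).
    by apply: ex_derive_continuous; auto_derive.
  apply: ex_derive_continuous; eexists; apply: is_derive_PSeries.
  by rewrite CV_radius_derive CV_radius_sin_n.
by apply: ex_derive_continuous; auto_derive.
Qed.

Lemma sinc_gt0 x : 0 <= x <= PI / 2 -> 0 < sinc x.
Proof.
move=> xr; have p0 := PI_RGT_0; have [x0|<-] : 0 < x \/ 0 = x by lra.
  have : 0 < x * sinc x by rewrite -sin_sinc; apply: sin_gt_0; lra.
  by move=> h; apply: (Rmult_lt_reg_l x) => //; rewrite Rmult_0_r.
rewrite /sinc /= Rmult_0_l PSeries_0 /sin_n /= /INR /=; lra.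
Qed.

(** x / sin x, extended by 1 at 0: a function of class C^1 on [0, pi/2], whence
    x^(j+1) / sin x is handled as x^j psi(x), without singularity at 0. *)
Definition psi (x : R) : R := / sinc x.
Definition dpsi (x : R) : R := - dsinc x / sinc x ^ 2.

Lemma sin_psi x : 0 <= x <= PI / 2 -> sin x * psi x = x.
Proof. by move=> /sinc_gt0 h; rewrite /psi sin_sinc; field; lra. Qed.

Lemma is_derive_psi {x} : 0 <= x <= PI / 2 -> is_derive psi x (dpsi x).
Proof.
move=> /sinc_gt0 h; apply: is_derive_inv; last by lra.
exact: is_derive_sinc.
Qed.

Lemma continuous_psi {x} : 0 <= x <= PI / 2 -> continuous psi x.
Proof.
by move=> xr; apply: ex_derive_continuous; exists (dpsi x); exact: is_derive_psi.
Qed.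

Lemma continuous_dpsi {x} : 0 <= x <= PI / 2 -> continuous dpsi x.
Proof.
move=> xr; have h := sinc_gt0 _ xr.
apply: (@continuous_mult _ R_AbsRing).
  apply: (@continuous_opp _ R_AbsRing R_NormedModule); exact: continuous_dsinc.
apply: (continuous_comp (fun y => sinc y ^ 2) Rinv).
  apply: ex_derive_continuous; eexists; apply: is_derive_pow; exact: is_derive_sinc.
by apply: continuous_Rinv; have := pow_lt _ 2 h; lra.
Qed.

Lemma Rmin_Rmax_0_PI2 : Rmin 0 (PI / 2) = 0 /\ Rmax 0 (PI / 2) = PI / 2.
Proof. by have := PI_RGT_0; rewrite /Rmin /Rmax; case: Rle_dec; lra. Qed.

Lemma ex_RInt_cont (f : R -> R) :
  (forall x, 0 <= x <= PI / 2 -> continuous f x) -> ex_RInt f 0 (PI / 2).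
Proof.
move=> H; apply: (@ex_RInt_continuous R_CompleteNormedModule) => x.
by rewrite (proj1 Rmin_Rmax_0_PI2) (proj2 Rmin_Rmax_0_PI2); exact: H.
Qed.

Lemma is_RInt_FTC (f df : R -> R) :
  (forall x, 0 <= x <= PI / 2 -> is_derive f x (df x)) ->
  (forall x, 0 <= x <= PI / 2 -> continuous df x) ->
  is_RInt df 0 (PI / 2) (f (PI / 2) - f 0).
Proof.
move=> H1 H2; apply: (@is_RInt_derive R_CompleteNormedModule) => x.
  by rewrite (proj1 Rmin_Rmax_0_PI2) (proj2 Rmin_Rmax_0_PI2); exact: H1.
by rewrite (proj1 Rmin_Rmax_0_PI2) (proj2 Rmin_Rmax_0_PI2); exact: H2.
Qed.

Lemma continuous_pow_psi j {x} : 0 <= x <= PI / 2 ->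
  continuous (fun y => y ^ j * psi y) x.
Proof.
move=> xr; apply: (@continuous_mult _ R_AbsRing); last exact: continuous_psi.
by apply: ex_derive_continuous; auto_derive.
Qed.

(** The integral of x^(j+1) / sin x over [0, pi/2]. *)
Definition psi_moment (j : nat) : R := RInt (fun x => x ^ j * psi x) 0 (PI / 2).

Lemma is_RInt_psi_moment j :
  is_RInt (fun x => x ^ j * psi x) 0 (PI / 2) (psi_moment j).
Proof.
apply: (@RInt_correct R_CompleteNormedModule); apply: ex_RInt_cont => x xr.
exact: continuous_pow_psi.
Qed.

(** * The integral of (1 - cos nx) / sin x *)

(** (1 - cos (n x)) / sin x as a trigonometric polynomial, to which the term
    tan (x/2) is added for odd [n]; [cos_quot_int n] is its integral over
    [0, pi/2]. *)
Fixpoint cos_quot (n : nat) (x : R) : R :=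
  match n with
  | 0 => 0
  | 1 => thalf x
  | n'.+2 => cos_quot n' x + 2 * sin (INR n'.+1 * x)
  end.

Fixpoint cos_quot_int (n : nat) : R :=
  match n with
  | 0 => 0
  | 1 => ln 2
  | n'.+2 => cos_quot_int n' + 2 * ((1 - cos (INR n'.+1 * (PI / 2))) / INR n'.+1)
  end.

Lemma nat_ind2 (P : nat -> Prop) :
  P 0%N -> P 1%N -> (forall n, P n -> P n.+2) -> forall n, P n.
Proof.
move=> P0 P1 PS n; suff: P n /\ P n.+1 by case.
by elim: n => [|n [h1 h2]]; split => //; exact: PS.
Qed.

Lemma sin_thalf {x} : 0 <= x <= PI / 2 -> sin x * (1 + thalf x ^ 2) = 2 * thalf x.
Proof.
move=> xr; have c := cos_half_gt xr; rewrite /thalf /tan.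
have -> : sin x = 2 * sin (x / 2) * cos (x / 2).
  by rewrite -sin_2a; congr sin; field.
have e := sin2_cos2 (x / 2); rewrite /Rsqr in e.
transitivity (2 * sin (x / 2)
  * (sin (x / 2) * sin (x / 2) + cos (x / 2) * cos (x / 2)) / cos (x / 2)).
  by field; lra.
by rewrite e; field; lra.
Qed.

Lemma sin_cos_quot n {x} : 0 <= x <= PI / 2 ->
  sin x * cos_quot n x = 1 - cos (INR n * x).
Proof.
move=> xr; elim/nat_ind2: n => [||n IH].
- by rewrite /INR Rmult_0_l cos_0 /=; ring.
- rewrite /= /INR Rmult_1_l; have c := cos_half_gt xr; rewrite /thalf /tan.
  have -> : cos x = 1 - 2 * sin (x / 2) * sin (x / 2).
    by rewrite -cos_2a_sin; congr cos; field.
  have -> : sin x = 2 * sin (x / 2) * cos (x / 2).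
    by rewrite -sin_2a; congr sin; field.
  by field; lra.
rewrite [cos_quot _ _]/= Rmult_plus_distr_l IH.
have -> : INR n * x = INR n.+1 * x - x by rewrite S_INR; ring.
have -> : INR n.+2 * x = INR n.+1 * x + x by rewrite (S_INR n.+1); ring.
by rewrite cos_plus cos_minus; ring.
Qed.

Lemma is_RInt_cos_quot n : is_RInt (cos_quot n) 0 (PI / 2) (cos_quot_int n).
Proof.
elim/nat_ind2: n => [||n IH].
- exact: is_RInt_zero.
- have -> : cos_quot_int 1 = (fun x => - logcos x) (PI / 2) - (fun x => - logcos x) 0.
    rewrite /= logcos0 /logcos; have -> : PI / 2 / 2 = PI / 4 by field.
    rewrite cos_PI4 /Rdiv Rmult_1_l ln_Rinv; last by apply: sqrt_lt_R0; lra.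
    have : ln (sqrt 2 * sqrt 2) = ln 2 by congr ln; apply: sqrt_sqrt; lra.
    by rewrite ln_mult; [lra|apply: sqrt_lt_R0; lra|apply: sqrt_lt_R0; lra].
  apply: (is_RInt_FTC (fun x => - logcos x)) => x xr.
    apply: (is_derive_eq _ _ (opp (- thalf x))); first by rewrite /opp /=; ring.
    apply: (@is_derive_opp _ R_NormedModule); exact: is_derive_logcos.
  by apply: ex_derive_continuous; eexists; exact: is_derive_thalf.
apply: (@is_RInt_plus R_NormedModule) => //.
apply: (@is_RInt_scal R_NormedModule).
have n0 := INR_neq0 (ltn0Sn n).
pose f x := - cos (INR n.+1 * x) / INR n.+1.
have -> : (1 - cos (INR n.+1 * (PI / 2))) / INR n.+1 = f (PI / 2) - f 0.
  by rewrite /f Rmult_0_r cos_0; field.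
apply: is_RInt_FTC => x xr; first by rewrite /f; auto_derive => //; field.
by apply: ex_derive_continuous; auto_derive.
Qed.

(** * S as a limit of integrals of Fourier sums *)

(** [chain_poly d N] (thalf x) / sin x, using 1 / sin x = (1 + t^2) / (2 t). *)
Definition chain_quot (d N : nat) (x : R) : R :=
  \sum_(n < N.+1) (chain_coef d n / INR n * (thalf x ^ n.-1 * ((1 + thalf x ^ 2) / 2))).

Lemma sin_chain_quot d N {x} : 0 <= x <= PI / 2 ->
  sin x * chain_quot d N x = chain_poly d N (thalf x).
Proof.
move=> xr; have e := sin_thalf xr.
rewrite sumR_scal; apply: eq_bigr => -[[|n] ?] _ /=.
  by rewrite chain_coef0 /Rdiv; ring.
transitivity (chain_coef d n.+1 / INR n.+1 * thalf x ^ n * (sin x * (1 + thalf x ^ 2)) / 2).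
  by field; apply: INR_neq0.
by rewrite e; field; apply: INR_neq0.
Qed.

Lemma continuous_thalf_pow n {x} : 0 <= x <= PI / 2 ->
  continuous (fun y => thalf y ^ n) x.
Proof.
by move=> xr; apply: ex_derive_continuous; eexists; exact: is_derive_thalf_pow.
Qed.

Lemma is_RInt_chain_quot d N : is_RInt (chain_quot d N) 0 (PI / 2)
  (\sum_(n < N.+1) (chain_coef d n / INR n ^ 2)).
Proof.
apply: is_RInt_sumR => -[[|n] ?] _ /=.
  rewrite chain_coef0 /Rdiv !Rmult_0_l.
  apply: (is_RInt_ext (fun=> 0)) => [x _|]; first by rewrite Rmult_0_l.
  exact: is_RInt_zero.
have n0 := INR_neq0 (ltn0Sn n).
have -> : chain_coef d n.+1 / (INR n.+1 * (INR n.+1 * 1))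
   = chain_coef d n.+1 / INR n.+1 * (/ INR n.+1 * thalf (PI / 2) ^ n.+1 - / INR n.+1 * thalf 0 ^ n.+1).
  by rewrite thalf_PI2 thalf0 pow1 /= Rmult_0_l; field.
apply: (@is_RInt_scal R_NormedModule).
apply: (is_RInt_FTC (fun x => / INR n.+1 * thalf x ^ n.+1)) => x xr.
  apply: (is_derive_eq _ _ (/ INR n.+1 * (INR n.+1 * (thalf x ^ n * ((1 + thalf x ^ 2) / 2))))).
    by rewrite /=; field.
  by apply: is_derive_scal; exact: is_derive_thalf_pow.
apply: (@continuous_mult _ R_AbsRing); first exact: continuous_thalf_pow.
apply: (@continuous_mult _ R_AbsRing); last exact: continuous_const.
apply: (@continuous_plus R_UniformSpace R_AbsRing R_NormedModule); first exact: continuous_const.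
exact: (continuous_thalf_pow 2).
Qed.

(** [fourier_sum (2 l) N x] / sin x, and its integral over [0, pi/2]. *)
Definition fourier_quot (l N : nat) (x : R) : R :=
  2 * \sum_(n < N) ((-1) ^ n / INR n.+1 ^ (2 * l + 1) *
    (- cos_quot n.+1 x
     - \sum_(i < l) ((-1) ^ i.+1 / INR (2 * i.+1)`! * INR n.+1 ^ (2 * i.+1)
                     * (x ^ (2 * i + 1) * psi x)))).

Definition fourier_int (l N : nat) : R :=
  2 * \sum_(n < N) ((-1) ^ n / INR n.+1 ^ (2 * l + 1) *
    (- cos_quot_int n.+1
     - \sum_(i < l) ((-1) ^ i.+1 / INR (2 * i.+1)`! * INR n.+1 ^ (2 * i.+1)
                     * psi_moment (2 * i + 1)))).

Lemma sin_fourier_quot l N {x} : 0 <= x <= PI / 2 ->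
  sin x * fourier_quot l N x = fourier_sum (2 * l) N x.
Proof.
move=> xr; rewrite /fourier_quot /fourier_sum -Rmult_assoc (Rmult_comm _ 2) Rmult_assoc.
congr (_ * _); rewrite sumR_scal; apply: eq_bigr => n _.
rewrite addn1 /trig_rem mul2n odd_double doubleK /cos_rem big_ord_recl.
rewrite -Rmult_assoc (Rmult_comm (sin x)) Rmult_assoc; congr (_ * _).
rewrite Rmult_minus_distr_l -Ropp_mult_distr_r sin_cos_quot // muln0 fact0.
rewrite [X in _ = _ - (X + _)](_ : _ = 1); last by rewrite /= /INR; field.
rewrite sumR_scal.
have aux (a b c : R) : b = c -> - (1 - a) - b = a - (1 + c) by move=> ->; ring.
apply: aux; apply: eq_bigr => i _; rewrite Rpow_mult_distr lift0.
have -> : x ^ (2 * i.+1) = (sin x * psi x) * x ^ (2 * i + 1).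
  by rewrite sin_psi // mulnS add2n addn1.
by ring.
Qed.

Lemma is_RInt_fourier_quot l N :
  is_RInt (fourier_quot l N) 0 (PI / 2) (fourier_int l N).
Proof.
apply: (@is_RInt_scal R_NormedModule); apply: is_RInt_sumR => n _.
apply: (@is_RInt_scal R_NormedModule).
apply: (@is_RInt_minus R_NormedModule).
  by apply: (@is_RInt_opp R_NormedModule); exact: is_RInt_cos_quot.
apply: is_RInt_sumR => i _; apply: (@is_RInt_scal R_NormedModule).
exact: is_RInt_psi_moment.
Qed.

Lemma thalf_le_sin {x} : 0 <= x <= PI / 2 -> thalf x <= sin x.
Proof.
move=> xr; have e := sin_thalf xr; have [t0 t1] := thalf_range xr.
have s0 : 0 <= sin x by apply: sin_ge_0; have := PI_RGT_0; lra.
have t2 : thalf x ^ 2 <= 1 by have [] := thalf_pow_range 2 xr.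
have : sin x * thalf x ^ 2 <= sin x * 1 by apply: Rmult_le_compat_l.
by lra.
Qed.

Lemma chain_int_compare l N :
  Rabs (\sum_(n < N.+2) (chain_coef (2 * l.+1) n / INR n ^ 2) - fourier_int l.+1 N)
  <= compare_err (2 * l.+1) N * (PI / 2).
Proof.
have p0 := PI_RGT_0.
have := is_RInt_minus _ _ _ _ _ _ (is_RInt_chain_quot (2 * l.+1) N.+1)
  (is_RInt_fourier_quot l.+1 N).
set f := fun _ => minus _ _; set v := minus _ _ => Hf.
rewrite -[X in Rabs X]/v -(is_RInt_unique _ _ _ _ Hf).
have fe : ex_RInt f 0 (PI / 2) by exists v.
have Hc := @is_RInt_const R_NormedModule 0 (PI / 2) (compare_err (2 * l.+1) N).
rewrite [X in _ <= X](_ : _ = RInt (fun=> compare_err (2 * l.+1) N) 0 (PI / 2)); last first.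
  by rewrite (is_RInt_unique _ _ _ _ Hc) /scal /= /mult /=; ring.
apply: Rle_trans (abs_RInt_le _ _ _ _ fe) _; first lra.
apply: RInt_le; [lra| |by eexists; exact: Hc|].
  exact: ex_RInt_norm.
move=> x xb; have xr : 0 <= x <= PI / 2 by lra.
have s0 : 0 < sin x by apply: sin_gt_0; lra.
apply: (Rmult_le_reg_l (sin x)) => //.
rewrite -{1}(Rabs_pos_eq (sin x)) -?Rabs_mult; last by lra.
rewrite (_ : sin x * f x
  = chain_poly (2 * l.+1) N.+1 (thalf x) - fourier_sum (2 * l.+1) N x); last first.
  rewrite -(sin_chain_quot _ _ xr) -(sin_fourier_quot _ _ xr).
  by rewrite /f /minus /plus /opp /=; ring.
have := chain_fourier (2 * l).+1 N xr; have := thalf_le_sin xr.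
rewrite -[(2 * l).+2]add2n -mulnS => ts h; apply: Rle_trans h _.
rewrite Rmult_comm; apply: Rmult_le_compat_r => //.
exact: compare_err_ge0.
Qed.

Lemma S_trunc_coef l N :
  2 ^ (2 * l).+1 *
    \big[Rplus/R0]_(n : {ffun 'I_(2 * l).+1 -> 'I_N.+1} | S_index n) S_term n
  = \sum_(n < N.+1) (chain_coef (2 * l) n / INR n ^ 2).
Proof.
rewrite S_truncE sumR_scal big_mkcond; apply: eq_bigr => n _.
rewrite /chain_coef mul2n odd_double eqbF_neg.
by case: ifP => _; rewrite /Rdiv; ring.
Qed.

(** Since dt / t = dx / sin x, the truncations of S are integrals of
    [chain_quot], whose distance to those of [fourier_quot] tends to 0. *)
Lemma S_bar2_ones_lim l (v : R) : is_lim_seq (fourier_int l.+1) v ->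
  S_bar2_ones l.+1 = v.
Proof.
move=> H; rewrite /S_bar2_ones.
set u := fun N : nat => _.
suff Hu : is_lim_seq (fun N => 2 ^ (2 * l.+1).+1 * u N) v.
  have p0 : 2 ^ (2 * l.+1).+1 <> 0 by apply: pow_nonzero; lra.
  have : is_lim_seq u (v / 2 ^ (2 * l.+1).+1).
    apply: (is_lim_seq_ext (fun N => / 2 ^ (2 * l.+1).+1 * (2 ^ (2 * l.+1).+1 * u N))).
      by move=> n; field.
    have -> : v / 2 ^ (2 * l.+1).+1 = / 2 ^ (2 * l.+1).+1 * v by field.
    exact: (is_lim_seq_scal_l _ (/ 2 ^ (2 * l.+1).+1) v Hu).
  move=> /is_lim_seq_unique ->; rewrite [real _](_ : _ = v / 2 ^ (2 * l.+1).+1) //.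
  by field.
apply/(is_lim_seq_incr_n _ 2).
apply: (is_lim_seq_ext (fun N => fourier_int l.+1 N +
   (\sum_(n < N.+2) (chain_coef (2 * l.+1) n / INR n ^ 2) - fourier_int l.+1 N))).
  by move=> N; rewrite /u plusE addn2 S_trunc_coef; ring.
(* [chain_int_compare] bounds the second summand. *)
rewrite -(Rplus_0_r v); apply: is_lim_seq_plus' => //.
apply/is_lim_seq_abs_0.
apply: (is_lim_seq_le_le (fun=> 0) _ (fun N => compare_err (2 * l.+1) N * (PI / 2)) 0).
- by move=> n; split; [exact: Rabs_pos|exact: chain_int_compare].
- exact: is_lim_seq_const.
have := is_lim_seq_scal_r _ (PI / 2) _ (compare_err_lim (2 * l.+1)).
by rewrite /= Rmult_0_l.
Qed.

(** * Special values: eta, lambda and log 2 *)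

Lemma Series_psum_lim (f : nat -> R) : ex_series f ->
  is_lim_seq (fun N => \sum_(n < N) f n) (Series f).
Proof.
move=> H; apply/is_lim_seq_incr_1.
apply: (is_lim_seq_ext (sum_n f)) => [n|]; first exact: sum_nE.
exact: Series_correct.
Qed.

Lemma is_series_psum (f : nat -> R) (v : R) :
  is_lim_seq (fun N => \sum_(n < N) f n) v -> is_series f v.
Proof.
move=> H; have /is_lim_seq_incr_1 {}H := H.
by apply: (is_lim_seq_ext _ _ _ _ H) => n; rewrite sum_nE.
Qed.

Lemma Series_psum_unique (f : nat -> R) (v : R) :
  is_lim_seq (fun N => \sum_(n < N) f n) v -> Series f = v.
Proof. by move=> /is_series_psum; exact: is_series_unique. Qed.

Lemma ex_series_inv_sq : ex_series (fun n => / INR n.+1 ^ 2).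
Proof.
apply: (@ex_series_le R_AbsRing R_CompleteNormedModule _
  (fun n => 2 * (/ INR n.+1 - / INR n.+2))) => [n|].
  have n0 := INR_gt0 (ltn0Sn n).
  rewrite /norm /= /abs /= Rabs_pos_eq; last first.
    by apply/Rlt_le/Rinv_0_lt_compat; apply: Rmult_lt_0_compat; lra.
  have -> : 2 * (/ INR n.+1 - / INR n.+2) = / (INR n.+1 * (INR n.+2 / 2)).
    by rewrite (S_INR n.+1); field; lra.
  have n1 : 1 <= INR n.+1 by apply: (INR_leq (m := 1)).
  have e := S_INR n.+1.
  apply: Rinv_le_contravar; first by apply: Rmult_lt_0_compat; lra.
  by apply: Rmult_le_compat_l; lra.
exists 2; apply: is_series_psum.
apply: (is_lim_seq_ext (fun N => 2 - 2 * / INR N.+1)) => [N|].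
  rewrite -sumR_scal; have aux a b : b = 1 - a -> 2 - 2 * a = 2 * b by move=> ->; ring.
  apply: aux.
  elim: N => [|N IH]; first by rewrite big_ord0 /INR; field.
  by rewrite big_ord_recr IH /=; ring.
have h : is_lim_seq (fun N => / INR N.+1) 0.
  apply: (is_lim_seq_inv (fun N => INR N.+1) p_infty) => //.
  exact: (proj1 (is_lim_seq_incr_1 _ _) is_lim_seq_INR).
have := is_lim_seq_minus' _ _ _ _ (is_lim_seq_const 2) (is_lim_seq_scal_l _ 2 _ h).
by rewrite /= Rmult_0_r Rminus_0_r.
Qed.

Lemma ex_series_zeta s : (2 <= s)%N -> ex_series (fun n => / INR n.+1 ^ s).
Proof.
move=> s2; apply: (@ex_series_le R_AbsRing R_CompleteNormedModule _ _ _ ex_series_inv_sq) => n.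
have n0 := INR_gt0 (ltn0Sn n).
have n1 : 1 <= INR n.+1 by apply: (INR_leq (m := 1)).
rewrite /norm /= /abs /= Rabs_pos_eq; last first.
  by apply/Rlt_le/Rinv_0_lt_compat; exact: pow_lt.
apply: Rinv_le_contravar; first exact: (pow_lt _ 2).
by apply: (Rle_pow _ 2) => //; apply/leP.
Qed.

Lemma ex_series_alt (u : nat -> R) :
  (forall n, u n.+1 <= u n) -> is_lim_seq u 0 -> ex_series (fun n => (-1) ^ n * u n).
Proof.
move=> H1 H2; have [v Hv] := alternated_series u H1 (proj1 (is_lim_seq_Reals _ _) H2).
by exists v; apply/is_series_Reals.
Qed.

Lemma ex_series_alt_inv (x : nat -> R) s : (1 <= s)%N ->
  (forall n, 0 < x n) -> (forall n, x n <= x n.+1) -> is_lim_seq x p_infty ->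
  ex_series (fun n => (-1) ^ n / x n ^ s).
Proof.
case: s => // s _ x0 x1 xl; apply: ex_series_alt => [n|].
  apply: Rinv_le_contravar; first exact: pow_lt.
  by apply: pow_incr; split => //; exact: Rlt_le.
apply: (is_lim_seq_ext (fun n => (/ x n) ^ s.+1)) => [n|]; first by rewrite pow_inv.
have h : is_lim_seq (fun n => / x n) 0 by apply: (is_lim_seq_inv _ p_infty).
elim: s => [|s IH].
  by apply: (is_lim_seq_ext (fun n => / x n)) => // n; rewrite /= Rmult_1_r.
have := is_lim_seq_mult' _ _ _ _ h IH; rewrite Rmult_0_l.
by apply: is_lim_seq_ext.
Qed.

Lemma is_lim_seq_INR_odd : is_lim_seq (fun n => INR (2 * n + 1)) p_infty.
Proof.
apply: (is_lim_seq_le_p_loc INR); last exact: is_lim_seq_INR.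
exists 0%N => n _; apply: INR_leq; lia.
Qed.

Lemma is_lim_seq_INR_S : is_lim_seq (fun n => INR n.+1) p_infty.
Proof. exact: (proj1 (is_lim_seq_incr_1 _ _) is_lim_seq_INR). Qed.

(** The Dirichlet eta function and the sum over odd integers. *)
Definition eta (s : nat) : R := Series (fun n => (-1) ^ n / INR n.+1 ^ s).
Definition lambda (s : nat) : R := Series (fun n => / INR (2 * n + 1) ^ s).

Lemma eta_lim s : (1 <= s)%N ->
  is_lim_seq (fun N => \sum_(n < N) ((-1) ^ n / INR n.+1 ^ s)) (eta s).
Proof.
move=> s1; apply: Series_psum_lim; apply: ex_series_alt_inv => //.
- by move=> n; exact: INR_gt0.
- by move=> n; apply: INR_leq; lia.
- exact: is_lim_seq_INR_S.
Qed.

Lemma beta_lim s : (1 <= s)%N ->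
  is_lim_seq (fun N => \sum_(n < N) ((-1) ^ n / INR (2 * n + 1) ^ s)) (beta s).
Proof.
move=> s1; apply: Series_psum_lim; apply: ex_series_alt_inv => //.
- by move=> n; apply: INR_gt0; lia.
- by move=> n; apply: INR_leq; lia.
- exact: is_lim_seq_INR_odd.
Qed.

Lemma zeta_lim s : (2 <= s)%N ->
  is_lim_seq (fun N => \sum_(n < N) / INR n.+1 ^ s) (zeta s).
Proof. by move=> s2; apply: Series_psum_lim; exact: ex_series_zeta. Qed.

Lemma is_lim_seq_double (u : nat -> R) (v : R) :
  is_lim_seq u v -> is_lim_seq (fun n => u (2 * n)%N) v.
Proof.
move=> H; apply: (is_lim_seq_subseq u _ (fun n => 2 * n)%N) => //.
by apply: eventually_subseq => n; lia.
Qed.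

Lemma sum_double (f : nat -> R) N :
  \sum_(n < (2 * N)%N) f n = \sum_(n < N) (f (2 * n)%N + f (2 * n + 1)%N).
Proof.
elim: N => [|N IH]; first by rewrite muln0 !big_ord0.
by rewrite mulnS add2n !big_ord_recr IH /= addn1; ring.
Qed.

Lemma INR_2nS n : INR (2 * n + 1).+1 = 2 * INR n.+1.
Proof. by rewrite !S_INR INRD INRM /INR; ring. Qed.

Lemma lambda_lim s : (2 <= s)%N ->
  is_lim_seq (fun N => \sum_(n < N) / INR (2 * n + 1) ^ s) ((1 - / 2 ^ s) * zeta s).
Proof.
move=> s2; have p0 : 2 ^ s <> 0 by apply: pow_nonzero; lra.
have := is_lim_seq_minus' _ _ _ _ (is_lim_seq_double _ _ (zeta_lim _ s2))
  (is_lim_seq_scal_l _ (/ 2 ^ s) _ (zeta_lim _ s2)).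
have -> : (1 - / 2 ^ s) * zeta s = zeta s - / 2 ^ s * zeta s by ring.
apply: is_lim_seq_ext => N; rewrite (sum_double (fun n => / INR n.+1 ^ s)).
rewrite sumR_scal sumR_sub; apply: eq_bigr => n _.
rewrite INR_2nS Rpow_mult_distr addn1.
have h := pow_nonzero _ s (INR_neq0 (ltn0Sn n)).
have h2 := pow_nonzero _ s (INR_neq0 (ltn0Sn (2 * n))).
by field.
Qed.

Lemma lambdaE s : (2 <= s)%N -> lambda s = (1 - / 2 ^ s) * zeta s.
Proof. by move=> s2; apply: Series_psum_unique; exact: lambda_lim. Qed.

Lemma pow_m1_double n : (-1) ^ (2 * n) = 1.
Proof. by rewrite pow_m1E mul2n odd_double. Qed.

Lemma etaE s : (2 <= s)%N -> eta s = (1 - 2 * / 2 ^ s) * zeta s.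
Proof.
move=> s2; have p0 : 2 ^ s <> 0 by apply: pow_nonzero; lra.
have h1 := is_lim_seq_double _ _ (eta_lim s (ltnW s2)).
have := is_lim_seq_minus' _ _ _ _ (is_lim_seq_double _ _ (zeta_lim _ s2))
  (is_lim_seq_scal_l _ (2 * / 2 ^ s) _ (zeta_lim _ s2)).
have -> : (1 - 2 * / 2 ^ s) * zeta s = zeta s - 2 * / 2 ^ s * zeta s by ring.
move=> h2; have {}h2 : is_lim_seq (fun N => \sum_(n < (2 * N)%N) ((-1) ^ n / INR n.+1 ^ s)) 
   (zeta s - 2 * / 2 ^ s * zeta s).
  apply: is_lim_seq_ext h2 => N; rewrite (sum_double (fun n => (-1) ^ n / INR n.+1 ^ s)).
  rewrite (sum_double (fun n => / INR n.+1 ^ s)).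
  rewrite sumR_scal sumR_sub; apply: eq_bigr => n _.
  rewrite INR_2nS Rpow_mult_distr addn1 [(-1) ^ _.+1]/= pow_m1_double.
  have h := pow_nonzero _ s (INR_neq0 (ltn0Sn n)).
  have h3 := pow_nonzero _ s (INR_neq0 (ltn0Sn (2 * n))).
  by field.
by have := is_lim_seq_unique _ _ h1; rewrite (is_lim_seq_unique _ _ h2) => -[].
Qed.

(** The partial sums of the series of log 2. *)
Definition alt_harm (k : nat) : R := \sum_(n < k) ((-1) ^ n / INR n.+1).

(** log (1 + x) differs from its truncated series by a function of derivative
    (-x)^k / (1 + x). *)
Lemma alt_harm_ln2 k : Rabs (ln 2 - alt_harm k) <= / INR k.+1.
Proof.
have k0 := INR_neq0 (ltn0Sn k).
pose f x := ln (1 + x) - \sum_(n < k) ((-1) ^ n / INR n.+1 * x ^ n.+1).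
have -> : ln 2 - alt_harm k = f 1.
  rewrite /f /alt_harm (_ : 1 + 1 = 2); last by ring.
  by congr (_ - _); apply: eq_bigr => n _; rewrite pow1 Rmult_1_r.
have -> : / INR k.+1 = / INR k.+1 * 1 ^ k.+1 by rewrite pow1 Rmult_1_r.
apply: (derive_compare f (fun x => / (1 + x) - \sum_(n < k) (- x) ^ n)
  (fun x => / INR k.+1 * x ^ k.+1) (fun x => x ^ k) 1); last by lra.
- move=> x xr; apply: (@is_derive_minus _ R_NormedModule).
    by auto_derive; [lra|rewrite /= Rmult_1_l].
  apply: is_derive_sumR => n _.
  have n0 := INR_neq0 (ltn0Sn n).
  apply: (is_derive_eq _ _ ((-1) ^ n / INR n.+1 * (INR n.+1 * 1 * x ^ n))).
    have -> : - x = -1 * x by ring.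
    by rewrite Rpow_mult_distr; field.
  apply: is_derive_scal; apply: is_derive_pow; exact: is_derive_id.
- move=> x xr; apply: (is_derive_eq _ _ (/ INR k.+1 * (INR k.+1 * 1 * x ^ k))).
    by field.
  apply: is_derive_scal; apply: is_derive_pow; exact: is_derive_id.
- move=> x xr.
  have -> : / (1 + x) - \sum_(n < k) (- x) ^ n = (- x) ^ k / (1 + x).
    have : (1 + x) * \sum_(n < k) (- x) ^ n = 1 - (- x) ^ k.
      elim: k {k0 f} => [|k IH]; first by rewrite big_ord0 /=; ring.
      by rewrite big_ord_recr Rmult_plus_distr_l IH /=; ring.
    move=> e; apply: (Rmult_eq_reg_l (1 + x)); last by lra.
    by rewrite Rmult_minus_distr_l e; field; lra.
  have -> : - x = -1 * x by ring.
  rewrite Rpow_mult_distr /Rdiv !Rabs_mult pow_1_abs Rmult_1_l.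
  have xk : 0 <= x ^ k by apply: pow_le; lra.
  rewrite Rabs_pos_eq // Rabs_pos_eq; last by apply/Rlt_le/Rinv_0_lt_compat; lra.
  rewrite -[X in _ <= X]Rmult_1_r; apply: Rmult_le_compat_l => //.
  by rewrite -[X in _ <= X]Rinv_1; apply: Rinv_le_contravar; lra.
- rewrite /f Rplus_0_r ln_1 big1 ?Rminus_0_r // => n _.
  by rewrite /= Rmult_0_l Rmult_0_r.
- by rewrite /= Rmult_0_l Rmult_0_r.
Qed.

Lemma is_lim_seq_inv_INR : is_lim_seq (fun n => / INR n.+1) 0.
Proof.
by apply: (is_lim_seq_inv (fun N => INR N.+1) p_infty) => //; exact: is_lim_seq_INR_S.
Qed.

Lemma alt_harm_lim : is_lim_seq alt_harm (ln 2).
Proof.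
have H : is_lim_seq (fun k => ln 2 - alt_harm k) 0.
  apply/is_lim_seq_abs_0.
  apply: (is_lim_seq_le_le (fun=> 0) _ (fun k => / INR k.+1) 0).
  - by move=> n; split; [exact: Rabs_pos|exact: alt_harm_ln2].
  - exact: is_lim_seq_const.
  - exact: is_lim_seq_inv_INR.
have := is_lim_seq_minus' _ _ _ _ (is_lim_seq_const (ln 2)) H.
by rewrite Rminus_0_r; apply: is_lim_seq_ext => n; ring.
Qed.

Lemma eta1 : eta 1 = ln 2.
Proof.
apply: Series_psum_unique; apply: is_lim_seq_ext alt_harm_lim => N.
by apply: eq_bigr => n _; rewrite pow_1.
Qed.

(** * Oscillating integrals *)

(** The phase [phi] covers both cos (phi = 0) and sin (phi = - pi/2). *)
Lemma riemann_lebesgue_bound (f df : R -> R) w phi : 0 < w ->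
  (forall x, 0 <= x <= PI / 2 -> is_derive f x (df x)) ->
  (forall x, 0 <= x <= PI / 2 -> continuous df x) ->
  Rabs (RInt (fun x => f x * cos (w * x + phi)) 0 (PI / 2))
  <= (Rabs (f (PI / 2)) + Rabs (f 0) + RInt (fun x => Rabs (df x)) 0 (PI / 2)) * / w.
Proof.
move=> w0 Hf Hdf; have p0 := PI_RGT_0; have iw := Rinv_0_lt_compat _ w0.
have cf x : 0 <= x <= PI / 2 -> continuous f x.
  by move=> xr; apply: ex_derive_continuous; exists (df x); exact: Hf.
have ct (g : R -> R) (h : R -> R) : (forall x, 0 <= x <= PI / 2 -> continuous g x) ->
   (forall x, ex_derive h x) ->
   forall x, 0 <= x <= PI / 2 -> continuous (fun y => g y * h y) x.
  move=> Hg Hh x xr; apply: (@continuous_mult _ R_AbsRing); first exact: Hg.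
  exact: ex_derive_continuous.
have ec : forall x, ex_derive (fun x => cos (w * x + phi)) x by move=> x; auto_derive.
have es : forall x, ex_derive (fun x => sin (w * x + phi)) x by move=> x; auto_derive.
pose F x := / w * (f x * sin (w * x + phi)).
have HF : is_RInt (fun x => / w * (df x * sin (w * x + phi)) + f x * cos (w * x + phi))
   0 (PI / 2) (F (PI / 2) - F 0).
  apply: is_RInt_FTC => x xr.
    apply: (is_derive_eq _ _ (/ w * (df x * sin (w * x + phi) + f x * (w * cos (w * x + phi))))).
      by field; lra.
    apply: is_derive_scal; apply: (is_derive_mult f) => //; first exact: Hf.
      by auto_derive => //; ring.
    by move=> *; exact: Rmult_comm.
  apply: (@continuous_plus R_UniformSpace R_AbsRing R_NormedModule); last by apply: ct.
  apply: (@continuous_mult _ R_AbsRing); first exact: continuous_const.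
  exact: ct.
have e1 : ex_RInt (fun x => df x * sin (w * x + phi)) 0 (PI / 2).
  by apply: ex_RInt_cont; apply: ct.
have e2 : ex_RInt (fun x => f x * cos (w * x + phi)) 0 (PI / 2).
  by apply: ex_RInt_cont; apply: ct.
have e3 : ex_RInt (fun x => Rabs (df x)) 0 (PI / 2).
  by apply: (ex_RInt_norm df); apply: ex_RInt_cont.
have := is_RInt_unique _ _ _ _ (is_RInt_plus _ _ _ _ _ _
  (is_RInt_scal _ _ _ (/ w) _ (RInt_correct _ _ _ e1)) (RInt_correct _ _ _ e2)).
rewrite (is_RInt_unique _ _ _ _ HF) /plus /scal /= /mult /= => e.
set I1 := RInt (fun x => df x * _) _ _ in e *.
set I2 := RInt (fun x => f x * _) _ _ in e *.
have -> : I2 = / w * (f (PI / 2) * sin (w * (PI / 2) + phi) - f 0 * sin (w * 0 + phi) - I1).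
  by rewrite /F in e; lra.
rewrite Rabs_mult (Rabs_pos_eq (/ w)); last by lra.
rewrite Rmult_comm; apply: Rmult_le_compat_r; first lra.
have sb a b : Rabs (a * sin b) <= Rabs a.
  rewrite Rabs_mult -[X in _ <= X]Rmult_1_r; apply: Rmult_le_compat_l.
    exact: Rabs_pos.
  by apply: Rabs_le; exact: SIN_bound.
have b1 : Rabs I1 <= RInt (fun x => Rabs (df x)) 0 (PI / 2).
  apply: Rle_trans (abs_RInt_le _ _ _ _ e1) _; first lra.
  have e4 := ex_RInt_norm _ _ _ e1.
  apply: (RInt_le _ _ _ _ _ e4 e3) => [|x _]; [lra|exact: sb].
have b2 := sb (f (PI / 2)) (w * (PI / 2) + phi); have b3 := sb (f 0) (w * 0 + phi).
apply: Rle_trans (Rabs_triang _ _) _; rewrite Rabs_Ropp; apply: Rplus_le_compat => //.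
apply: Rle_trans (Rabs_triang _ _) _; rewrite Rabs_Ropp; lra.
Qed.

Lemma psi_moment_osc j phi :
  is_lim_seq (fun K => RInt (fun x => x ^ j * psi x * cos (INR (2 * K) * x + phi)) 0 (PI / 2)) 0.
Proof.
pose df x := INR j * 1 * x ^ j.-1 * psi x + x ^ j * dpsi x.
set f := fun x => x ^ j * psi x.
have Hf x : 0 <= x <= PI / 2 -> is_derive f x (df x).
  move=> xr; apply: (is_derive_mult (fun x => x ^ j)).
  - by apply: is_derive_pow; exact: is_derive_id.
  - exact: is_derive_psi.
  - by move=> *; exact: Rmult_comm.
have Hdf x : 0 <= x <= PI / 2 -> continuous df x.
  move=> xr; apply: (@continuous_plus R_UniformSpace R_AbsRing R_NormedModule).
    apply: (@continuous_mult _ R_AbsRing); last exact: continuous_psi.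
    by apply: ex_derive_continuous; auto_derive.
  apply: (@continuous_mult _ R_AbsRing); last exact: continuous_dpsi.
  by apply: ex_derive_continuous; auto_derive.
set C := Rabs (f (PI / 2)) + Rabs (f 0) + RInt (fun x => Rabs (df x)) 0 (PI / 2).
apply/is_lim_seq_abs_0.
apply: (is_lim_seq_le_le_loc (fun=> 0) _ (fun K => C * / INR K) 0).
- exists 1%N => K /leP K0; split; first exact: Rabs_pos.
  have k0 := INR_gt0 K0; have k2 : 0 < INR (2 * K) by apply: INR_gt0; lia.
  apply: Rle_trans (riemann_lebesgue_bound f df _ phi k2 Hf Hdf) _.
  apply: Rmult_le_compat_l.
    apply: Rplus_le_le_0_compat; first by apply: Rplus_le_le_0_compat; exact: Rabs_pos.
    apply: RInt_ge_0; [have := PI_RGT_0; lra| |by move=> *; exact: Rabs_pos].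
    by apply: (ex_RInt_norm df); exact: ex_RInt_cont.
  by apply: Rinv_le_contravar => //; apply: INR_leq; lia.
- exact: is_lim_seq_const.
have h : is_lim_seq (fun n => / INR n) 0.
  by apply: (is_lim_seq_inv INR p_infty) => //; exact: is_lim_seq_INR.
by have := is_lim_seq_scal_l _ C _ h; rewrite /= Rmult_0_r.
Qed.

(** * Moments of sine and cosine *)

Lemma sin_odd_PI2 j : sin (INR (2 * j + 1) * (PI / 2)) = (-1) ^ j.
Proof.
elim: j => [|j IH]; first by rewrite /= /INR Rmult_1_l sin_PI2.
have -> : INR (2 * j.+1 + 1) * (PI / 2) = INR (2 * j + 1) * (PI / 2) + PI.
  by rewrite mulnS -addnA INRD /INR; field.
by rewrite neg_sin IH /=; ring.
Qed.

Lemma cos_odd_PI2 j : cos (INR (2 * j + 1) * (PI / 2)) = 0.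
Proof.
elim: j => [|j IH]; first by rewrite /= /INR Rmult_1_l cos_PI2.
have -> : INR (2 * j.+1 + 1) * (PI / 2) = INR (2 * j + 1) * (PI / 2) + PI.
  by rewrite mulnS -addnA INRD /INR; field.
by rewrite neg_cos IH; ring.
Qed.

(** With n = 2j+1, [sin_moment j m] and [cos_moment j m] are the integrals over
    [0, pi/2] of x^(2m)/(2m)! sin (n x) and x^(2m+1)/(2m+1)! cos (n x); the
    recursion is integration by parts. *)
Fixpoint sin_moment (j m : nat) : R :=
  let n := INR (2 * j + 1) in
  if m is m'.+1 then
    ((-1) ^ j * (PI / 2) ^ (2 * m' + 1) / INR (2 * m' + 1)`! / n - sin_moment j m' / n) / n
  else / n.

Definition cos_moment (j m : nat) : R :=
  let n := INR (2 * j + 1) in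
  (-1) ^ j * (PI / 2) ^ (2 * m + 1) / INR (2 * m + 1)`! / n - sin_moment j m / n.

Lemma is_RInt_sub_cont (f g : R -> R) (a b : R) :
  is_RInt (fun x => f x + g x) 0 (PI / 2) a -> is_RInt f 0 (PI / 2) b ->
  is_RInt g 0 (PI / 2) (a - b).
Proof.
move=> H1 H2; apply: is_RInt_ext (is_RInt_minus _ _ _ _ _ _ H1 H2) => x _.
by rewrite /minus /plus /opp /=; ring.
Qed.

Lemma is_RInt_cos_moment_step j m :
  is_RInt (fun x => x ^ (2 * m) / INR (2 * m)`! * sin (INR (2 * j + 1) * x)) 0 (PI / 2)
    (sin_moment j m) ->
  is_RInt (fun x => x ^ (2 * m + 1) / INR (2 * m + 1)`! * cos (INR (2 * j + 1) * x))
    0 (PI / 2) (cos_moment j m).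
Proof.
move=> H; have n0 : INR (2 * j + 1) <> 0 by apply: INR_neq0; lia.
have m0 : INR (2 * m + 1) <> 0 by apply: INR_neq0; lia.
have f0 := INR_neq0 (fact_gt0 (2 * m)).
have fS : INR (2 * m + 1)`! = INR (2 * m + 1) * INR (2 * m)`!.
  by rewrite addn1 factS INRM.
have fS0 := INR_neq0 (fact_gt0 (2 * m + 1)).
rewrite /cos_moment.
pose F x := x ^ (2 * m + 1) / INR (2 * m + 1)`! * sin (INR (2 * j + 1) * x) / INR (2 * j + 1).
have -> : (-1) ^ j * (PI / 2) ^ (2 * m + 1) / INR (2 * m + 1)`! / INR (2 * j + 1)
  = F (PI / 2) - F 0.
  by rewrite /F sin_odd_PI2 Rmult_0_r sin_0; field; split.
apply: (is_RInt_sub_cont (fun x => / INR (2 * j + 1) *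
    (x ^ (2 * m) / INR (2 * m)`! * sin (INR (2 * j + 1) * x)))).
  apply: is_RInt_FTC => x xr.
    rewrite /F; auto_derive => //; rewrite -/(INR (2 * m + 1)) -/(INR (2 * j + 1)).
    have -> : (2 * m + 1).-1 = (2 * m)%N by rewrite addn1.
    by rewrite fS; field; split.
  by apply: ex_derive_continuous; auto_derive.
have -> : sin_moment j m / INR (2 * j + 1) = / INR (2 * j + 1) * sin_moment j m.
  exact: Rmult_comm.
exact: (@is_RInt_scal R_NormedModule).
Qed.

Lemma is_RInt_sin_moment_step j m :
  is_RInt (fun x => x ^ (2 * m + 1) / INR (2 * m + 1)`! * cos (INR (2 * j + 1) * x))
    0 (PI / 2) (cos_moment j m) ->
  is_RInt (fun x => x ^ (2 * m.+1) / INR (2 * m.+1)`! * sin (INR (2 * j + 1) * x)) 0 (PI / 2)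
    (sin_moment j m.+1).
Proof.
move=> H; have n0 : INR (2 * j + 1) <> 0 by apply: INR_neq0; lia.
have m0 : INR (2 * m.+1) <> 0 by apply: INR_neq0; lia.
have f0 := INR_neq0 (fact_gt0 (2 * m + 1)).
have fS : INR (2 * m.+1)`! = INR (2 * m.+1) * INR (2 * m + 1)`!.
  by rewrite mulnS addnC -addn1 addnA [in LHS]addn1 factS -addn1 INRM.
have fS0 := INR_neq0 (fact_gt0 (2 * m.+1)).
pose F x := - (x ^ (2 * m.+1) / INR (2 * m.+1)`! * cos (INR (2 * j + 1) * x) / INR (2 * j + 1)).
have -> : sin_moment j m.+1 = F (PI / 2) - F 0 - (- (cos_moment j m / INR (2 * j + 1))).
  rewrite /F cos_odd_PI2 [0 ^ _]pow_i; last by lia.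
  by rewrite /= /cos_moment /Rdiv; ring.
apply: (is_RInt_sub_cont (fun x => - (/ INR (2 * j + 1) *
    (x ^ (2 * m + 1) / INR (2 * m + 1)`! * cos (INR (2 * j + 1) * x))))).
  apply: is_RInt_FTC => x xr.
    rewrite /F; auto_derive => //; rewrite -/(INR (2 * m.+1)) -/(INR (2 * j + 1)).
    have -> : (m + 1 * m.+1)%coq_nat = (2 * m + 1)%N by lia.
    have -> : x ^ (2 * m.+1) = x * x ^ (2 * m + 1).
      by rewrite (_ : (2 * m.+1)%N = (2 * m + 1).+1) //; lia.
    by rewrite fS; field; split.
  by apply: ex_derive_continuous; auto_derive.
apply: (@is_RInt_opp R_NormedModule).
have -> : cos_moment j m / INR (2 * j + 1) = / INR (2 * j + 1) * cos_moment j m.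
  exact: Rmult_comm.
exact: (@is_RInt_scal R_NormedModule).
Qed.

Lemma is_RInt_sin_moment j m :
  is_RInt (fun x => x ^ (2 * m) / INR (2 * m)`! * sin (INR (2 * j + 1) * x)) 0 (PI / 2)
    (sin_moment j m).
Proof.
elim: m => [|m IH]; last first.
  by apply: is_RInt_sin_moment_step; exact: is_RInt_cos_moment_step.
have n0 : INR (2 * j + 1) <> 0 by apply: INR_neq0; lia.
rewrite muln0 fact0.
pose F x := - cos (INR (2 * j + 1) * x) / INR (2 * j + 1).
have -> : sin_moment j 0 = F (PI / 2) - F 0.
  by rewrite /F cos_odd_PI2 Rmult_0_r cos_0 /=; field.
apply: is_RInt_FTC => x xr.
  by rewrite /F /=; auto_derive => //; rewrite /INR; field.
by apply: ex_derive_continuous; auto_derive.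
Qed.

Lemma is_RInt_cos_moment j m :
  is_RInt (fun x => x ^ (2 * m + 1) / INR (2 * m + 1)`! * cos (INR (2 * j + 1) * x))
    0 (PI / 2) (cos_moment j m).
Proof. apply: is_RInt_cos_moment_step; exact: is_RInt_sin_moment. Qed.

(** * Sums of beta values with powers of pi *)

(** The closed form, up to sign, of the moments above. With n = 2j+1 it is
    (-1)^j sin_rem (M/2) (n pi/2) / n^(M+2), because sin (n pi/2) = (-1)^j. *)
Definition odd_tail (j M : nat) : R :=
  let n := INR (2 * j + 1) in
  / n ^ (M + 2) - (-1) ^ j * \sum_(k < M./2.+1)
     ((-1) ^ k / INR (2 * k + 1)`! * (PI / 2) ^ (2 * k + 1) * / n ^ (M + 1 - 2 * k)).

Lemma half_2n m : (2 * m)./2 = m. Proof. by rewrite mul2n doubleK. Qed.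
Lemma half_2n1 m : (2 * m + 1)./2 = m.
Proof. by rewrite addn1 /= uphalf_half half_2n mul2n odd_double. Qed.

Lemma odd_tail_odd j m : odd_tail j (2 * m + 1) = odd_tail j (2 * m) / INR (2 * j + 1).
Proof.
have n0 : INR (2 * j + 1) <> 0 by apply: INR_neq0; lia.
rewrite /odd_tail half_2n1 half_2n; move: (INR _) n0 => n n0.
have pn k : n ^ k <> 0 by apply: pow_nonzero.
rewrite /Rdiv Rmult_minus_distr_r; congr (_ - _).
  rewrite (_ : (2 * m + 1 + 2)%N = (2 * m + 2).+1); last by lia.
  by rewrite [n ^ _.+1]/=; field.
rewrite Rmult_assoc; congr (_ * _).
rewrite [RHS]Rmult_comm sumR_scal; apply: eq_bigr => k _.
rewrite (_ : (2 * m + 1 + 1 - 2 * k)%N = (2 * m + 1 - 2 * k).+1); last by have := ltn_ord k; lia.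
have f0 := INR_neq0 (fact_gt0 (2 * k + 1)).
by rewrite [n ^ _.+1]/=; field.
Qed.

Lemma odd_tail_even_step j m : odd_tail j (2 * m.+1) = odd_tail j (2 * m) / INR (2 * j + 1) ^ 2
  - (-1) ^ j * ((-1) ^ m.+1 / INR (2 * m.+1 + 1)`! * (PI / 2) ^ (2 * m.+1 + 1)) / INR (2 * j + 1).
Proof.
have n0 : INR (2 * j + 1) <> 0 by apply: INR_neq0; lia.
rewrite /odd_tail !half_2n; move: (INR (2 * j + 1)) n0 => n n0.
have pn k : n ^ k <> 0 by apply: pow_nonzero.
have -> : \sum_(k < m.+2) ((-1) ^ k / INR (2 * k + 1)`! * (PI / 2) ^ (2 * k + 1) *
      / n ^ (2 * m.+1 + 1 - 2 * k))
  = / n ^ 2 * \sum_(k < m.+1) ((-1) ^ k / INR (2 * k + 1)`! * (PI / 2) ^ (2 * k + 1) *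
      / n ^ (2 * m + 1 - 2 * k))
    + (-1) ^ m.+1 / INR (2 * m.+1 + 1)`! * (PI / 2) ^ (2 * m.+1 + 1) / n.
  rewrite big_ord_recr; congr (_ + _); last first.
    by rewrite (_ : (2 * m.+1 + 1 - 2 * m.+1)%N = 1%N) ?pow_1 //; lia.
  rewrite sumR_scal; apply: eq_bigr => k _ /=.
  rewrite (_ : (2 * m.+1 + 1 - 2 * k)%N = (2 * m + 1 - 2 * k).+2); last by have := ltn_ord k; lia.
  have f0 := INR_neq0 (fact_gt0 (2 * k + 1)).
  by rewrite [n ^ _.+2]/=; field; repeat split.
rewrite (_ : (2 * m.+1 + 2)%N = (2 * m + 2).+2); last by lia.
have f0 := INR_neq0 (fact_gt0 (2 * m.+1 + 1)).
by rewrite [n ^ _.+2]/=; field; repeat split.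
Qed.

Lemma cos_momentE j m : cos_moment j m = (-1) ^ m.+1 * odd_tail j (2 * m).
Proof.
have n0 : INR (2 * j + 1) <> 0 by apply: INR_neq0; lia.
elim: m => [|m IH].
  rewrite /cos_moment /odd_tail (_ : (2 * 0)%N = 0%N) // big_ord_recr big_ord0 /=.
  rewrite (_ : INR (0 + 1)`! = 1) // (_ : R0 = 0) //.
  by field.
have e : cos_moment j m.+1
  = (-1) ^ j * (PI / 2) ^ (2 * m.+1 + 1) / INR (2 * m.+1 + 1)`! / INR (2 * j + 1)
  - cos_moment j m / INR (2 * j + 1) ^ 2.
  rewrite {1}/cos_moment [sin_moment _ _]/= -/(cos_moment j m).
  by have f0 := INR_neq0 (fact_gt0 (2 * m.+1 + 1)); field; split.
rewrite e IH odd_tail_even_step.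
have s : (-1) ^ m * (-1) ^ m = 1 by rewrite pow_m1E; case: odd; ring.
have f0 := INR_neq0 (fact_gt0 (2 * m.+1 + 1)).
rewrite [(-1) ^ m.+2]/= [(-1) ^ m.+1]/=.
move: (odd_tail _ _) ((PI / 2) ^ _) ((-1) ^ j) ((-1) ^ m) s (INR _`!) f0 => a b c d s f f0.
transitivity (- (-1 * d * a / INR (2 * j + 1) ^ 2) + (d * d) * (c * b / f / INR (2 * j + 1))).
  by rewrite s; field; split.
by field; split.
Qed.

Lemma sin_momentE j m : sin_moment j m.+1 = (-1) ^ m.+1 * odd_tail j (2 * m + 1).
Proof.
rewrite odd_tail_odd [LHS]/= -/(cos_moment j m) cos_momentE /Rdiv; ring.
Qed.

(** The sum of beta (r+1) (-1)^k / (2k+1)! (pi/2)^(2k+1) over r + 2k = M. *)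
Definition beta_pi_sum (M : nat) : R :=
  \sum_(k < M./2.+1)
     ((-1) ^ k / INR (2 * k + 1)`! * (PI / 2) ^ (2 * k + 1) * beta (M + 1 - 2 * k)).

Lemma odd_tail_lim M :
  is_lim_seq (fun K => \sum_(j < K) odd_tail j M) (lambda (M + 2) - beta_pi_sum M).
Proof.
have h1 : is_lim_seq (fun N => \sum_(n < N) / INR (2 * n + 1) ^ (M + 2)) (lambda (M + 2)).
  by rewrite lambdaE; [apply: lambda_lim|]; lia.
have h2 : is_lim_seq (fun K => \sum_(k < M./2.+1)
     ((-1) ^ k / INR (2 * k + 1)`! * (PI / 2) ^ (2 * k + 1)
      * \sum_(j < K) ((-1) ^ j / INR (2 * j + 1) ^ (M + 1 - 2 * k)))) (beta_pi_sum M).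
  apply: is_lim_seq_sumR => k _; apply: is_lim_seq_scalR.
  by apply: beta_lim; have := ltn_ord k; lia.
have := is_lim_seq_minus' _ _ _ _ h1 h2; apply: is_lim_seq_ext => K.
rewrite [X in _ - X](_ : _ = \sum_(k < M./2.+1) \sum_(j < K)
    ((-1) ^ k / INR (2 * k + 1)`! * (PI / 2) ^ (2 * k + 1)
     * ((-1) ^ j / INR (2 * j + 1) ^ (M + 1 - 2 * k)))); last first.
  by apply: eq_bigr => k _; rewrite sumR_scal.
rewrite exchange_big sumR_sub; apply: eq_bigr => j _.
rewrite /odd_tail sumR_scal; congr (_ - _); apply: eq_bigr => k _.
by rewrite /Rdiv; ring.
Qed.

Lemma sum_sin_odd K x :
  sin x * \sum_(j < K) sin (INR (2 * j + 1) * x) = (1 - cos (INR (2 * K) * x)) / 2.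
Proof.
elim: K => [|K IH]; first by rewrite big_ord0 muln0 /INR Rmult_0_l cos_0; field.
rewrite big_ord_recr Rmult_plus_distr_l IH /=.
have -> : INR (2 * K) * x = INR (2 * K + 1) * x - x by rewrite INRD /INR; ring.
have -> : INR (2 * K.+1) * x = INR (2 * K + 1) * x + x.
  by rewrite mulnS (_ : (2 + 2 * K)%N = (2 * K + 1 + 1)%N) ?(INRD (2 * K + 1)) /INR; [ring|lia].
by rewrite cos_plus cos_minus; field.
Qed.

Lemma sum_cos_odd K x :
  sin x * \sum_(j < K) cos (INR (2 * j + 1) * x) = sin (INR (2 * K) * x) / 2.
Proof.
elim: K => [|K IH]; first by rewrite big_ord0 muln0 /INR Rmult_0_l sin_0; field.
rewrite big_ord_recr Rmult_plus_distr_l IH /=.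
have -> : INR (2 * K) * x = INR (2 * K + 1) * x - x by rewrite INRD /INR; ring.
have -> : INR (2 * K.+1) * x = INR (2 * K + 1) * x + x.
  by rewrite mulnS (_ : (2 + 2 * K)%N = (2 * K + 1 + 1)%N) ?(INRD (2 * K + 1)) /INR; [ring|lia].
by rewrite sin_plus sin_minus; field.
Qed.

Lemma ex_RInt_osc j w phi :
  ex_RInt (fun x => x ^ j * psi x * cos (w * x + phi)) 0 (PI / 2).
Proof.
apply: ex_RInt_cont => x xr; apply: (@continuous_mult _ R_AbsRing).
  exact: continuous_pow_psi.
by apply: ex_derive_continuous; auto_derive.
Qed.

(** Multiplied by 2 sin x, the sum of the cos (2j+1)x becomes sin 2Kx: the sum
    of the moments is an oscillating integral. *)
Lemma sum_cos_moment K m :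
  \sum_(j < K) cos_moment j m = / (2 * INR (2 * m + 1)`!) *
   RInt (fun x => x ^ (2 * m) * psi x * cos (INR (2 * K) * x + - (PI / 2))) 0 (PI / 2).
Proof.
have H := is_RInt_sumR _ (fun=> true) _ _ _ _ (fun (j : 'I_K) _ => is_RInt_cos_moment j m).
rewrite -(is_RInt_unique _ _ _ _ H).
have H2 := is_RInt_scal _ _ _ (/ (2 * INR (2 * m + 1)`!)) _
  (RInt_correct _ _ _ (ex_RInt_osc (2 * m) (INR (2 * K)) (- (PI / 2)))).
apply: etrans (is_RInt_unique _ _ _ _ H2); apply: RInt_ext => x xr.
have {}xr : 0 <= x <= PI / 2.
  by move: xr; rewrite (proj1 Rmin_Rmax_0_PI2) (proj2 Rmin_Rmax_0_PI2); lra.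
rewrite -sumR_scal /scal /= /mult /=.
have -> : cos (INR (2 * K) * x + - (PI / 2)) = sin (INR (2 * K) * x).
  by rewrite -[RHS]cos_shift -cos_neg; congr cos; ring.
have -> : sin (INR (2 * K) * x) = 2 * (sin x * \sum_(j < K) cos (INR (2 * j + 1) * x)).
  by rewrite sum_cos_odd; field.
move: (\sum_(j < K) _) => s.
have -> : x ^ (2 * m + 1) = (sin x * psi x) * x ^ (2 * m) by rewrite sin_psi // addn1.
by field; apply: INR_neq0; exact: fact_gt0.
Qed.

Lemma sum_sin_moment K m :
  \sum_(j < K) sin_moment j m.+1 = / (2 * INR (2 * m.+1)`!) *
   (psi_moment (2 * m + 1)
    - RInt (fun x => x ^ (2 * m + 1) * psi x * cos (INR (2 * K) * x + 0)) 0 (PI / 2)).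
Proof.
have H := is_RInt_sumR _ (fun=> true) _ _ _ _ (fun (j : 'I_K) _ => is_RInt_sin_moment j m.+1).
rewrite -(is_RInt_unique _ _ _ _ H).
have H2 := is_RInt_scal _ _ _ (/ (2 * INR (2 * m.+1)`!)) _
  (is_RInt_minus _ _ _ _ _ _ (is_RInt_psi_moment (2 * m + 1))
  (RInt_correct _ _ _ (ex_RInt_osc (2 * m + 1) (INR (2 * K)) 0))).
apply: etrans (is_RInt_unique _ _ _ _ H2); apply: RInt_ext => x xr.
have {}xr : 0 <= x <= PI / 2.
  by move: xr; rewrite (proj1 Rmin_Rmax_0_PI2) (proj2 Rmin_Rmax_0_PI2); lra.
have -> : x ^ (2 * m.+1) = (sin x * psi x) * x ^ (2 * m + 1).
  by rewrite sin_psi // mulnS add2n addn1.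
rewrite -sumR_scal /scal /= /mult /= /minus /plus /opp /= Rplus_0_r.
have -> : cos (INR (2 * K) * x) = 1 - 2 * (sin x * \sum_(j < K) sin (INR (2 * j + 1) * x)).
  by rewrite sum_sin_odd; field.
move: (\sum_(j < K) _) => s.
by field; apply: INR_neq0; exact: fact_gt0.
Qed.

Lemma is_lim_seq_uniq (u : nat -> R) (a b : R) : is_lim_seq u a -> is_lim_seq u b -> a = b.
Proof.
by move=> /is_lim_seq_unique h1 /is_lim_seq_unique; rewrite h1 => -[].
Qed.

(** For even M the sum of the moments tends to 0. *)
Lemma beta_pi_sum_even m : beta_pi_sum (2 * m) = lambda (2 * m + 2).
Proof.
have h1 := is_lim_seq_scalR _ ((-1) ^ m.+1) _ (odd_tail_lim (2 * m)).
have h2 := is_lim_seq_scalR _ (/ (2 * INR (2 * m + 1)`!)) _ (psi_moment_osc (2 * m) (- (PI / 2))).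
have h3 : is_lim_seq (fun K => (-1) ^ m.+1 * \sum_(j < K) odd_tail j (2 * m))
   (/ (2 * INR (2 * m + 1)`!) * 0).
  apply: is_lim_seq_ext h2 => K; rewrite -sum_cos_moment sumR_scal.
  by apply: eq_bigr => j _; rewrite cos_momentE.
have := is_lim_seq_uniq _ _ _ h1 h3; rewrite Rmult_0_r => /Rmult_integral [e|]; last by lra.
by have := pow_nonzero (-1) m.+1; lra.
Qed.

(** For odd M the limit is half the integral of x^(M+1)/(M+1)! / sin x. *)
Lemma beta_pi_sum_odd m :
  psi_moment (2 * m + 1) = 2 * INR (2 * m.+1)`! *
   ((-1) ^ m.+1 * (lambda (2 * m + 3) - beta_pi_sum (2 * m + 1))).
Proof.
have f0 := INR_neq0 (fact_gt0 (2 * m.+1)).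
have h1 := is_lim_seq_scalR _ ((-1) ^ m.+1) _ (odd_tail_lim (2 * m + 1)).
have h2 := is_lim_seq_scalR _ (/ (2 * INR (2 * m.+1)`!)) _
 (is_lim_seq_minus' _ _ _ _ (is_lim_seq_const (psi_moment (2 * m + 1))) (psi_moment_osc (2 * m + 1) 0)).
have h3 : is_lim_seq (fun K => (-1) ^ m.+1 * \sum_(j < K) odd_tail j (2 * m + 1))
   (/ (2 * INR (2 * m.+1)`!) * (psi_moment (2 * m + 1) - 0)).
  apply: is_lim_seq_ext h2 => K; rewrite -sum_sin_moment sumR_scal.
  by apply: eq_bigr => j _; rewrite sin_momentE.
have := is_lim_seq_uniq _ _ _ h1 h3; rewrite -addnA => ->.
by rewrite Rminus_0_r; field.
Qed.

(** * Alternating convolutions *)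

(** The geometric sum with ratio - x/y; its number of terms is odd. *)
Lemma partial_fractions x y l : 0 < x -> 0 < y ->
  \sum_(p < 2 * l + 1) ((-1) ^ p * (/ x ^ (2 * l + 1 - p) * / y ^ (p + 1)))
  = (/ x ^ (2 * l + 1) + / y ^ (2 * l + 1)) / (x + y).
Proof.
move=> x0 y0; set a := (2 * l + 1)%N.
have px k : x ^ k <> 0 by apply: pow_nonzero; lra.
have py k : y ^ k <> 0 by apply: pow_nonzero; lra.
have H m : (m <= a)%N ->
  (x + y) * \sum_(p < m) ((-1) ^ p * (/ x ^ (a - p) * / y ^ (p + 1)))
  = / x ^ a - (-1) ^ m * (/ x ^ (a - m) * / y ^ m).
  elim: m => [|m IH] ma; first by rewrite big_ord0 subn0 /=; field; exact: px.
  rewrite big_ord_recr Rmult_plus_distr_l IH; last exact: ltnW.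
  rewrite /= addn1 (_ : (a - m)%N = (a - m.+1).+1) /=; last by lia.
  by field; repeat split => //; lra.
have := H a (leqnn a); rewrite subnn pow_m1E [odd a](_ : _ = true) ?/a ?addn1 /= ?mul2n ?odd_double // => e.
apply: (Rmult_eq_reg_l (x + y)); last by lra.
by rewrite e -/(pow y (2 * l).+1); field; repeat split => //; try lra; exact: (py (2*l).+1).
Qed.

(** Partial fractions turn an alternating convolution into a double sum with a
    single linear form in the denominator. *)
Lemma convolution_identity (s x : nat -> R) l K : (forall n, 0 < x n) ->
  \sum_(p < 2 * l + 1) ((-1) ^ p * (\sum_(n < K) (s n / x n ^ (2 * l + 1 - p)))
                                 * (\sum_(m < K) (s m / x m ^ (p + 1))))
  = 2 * \sum_(n < K) (/ x n ^ (2 * l + 1) * \sum_(m < K) (s n * s m / (x n + x m))).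
Proof.
move=> x0.
transitivity (\sum_(n < K) \sum_(m < K) (s n * s m *
   ((/ x n ^ (2 * l + 1) + / x m ^ (2 * l + 1)) / (x n + x m)))).
  transitivity (\sum_(p < 2 * l + 1) \sum_(n < K) \sum_(m < K)
    (s n * s m * ((-1) ^ p * (/ x n ^ (2 * l + 1 - p) * / x m ^ (p + 1))))).
    apply: eq_bigr => p _; rewrite Rmult_assoc big_distrl /= sumR_scal.
    apply: eq_bigr => n _; rewrite big_distrr /= sumR_scal.
    by apply: eq_bigr => m _; rewrite /Rdiv; ring.
  rewrite exchange_big; apply: eq_bigr => n _.
  rewrite exchange_big; apply: eq_bigr => m _.
  by rewrite -partial_fractions // sumR_scal.
(* The two halves are exchanged by the symmetry between n and m. *)
transitivity (\sum_(n < K) \sum_(m < K) (/ x n ^ (2 * l + 1) * (s n * s m / (x n + x m)))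
  + \sum_(n < K) \sum_(m < K) (/ x m ^ (2 * l + 1) * (s m * s n / (x m + x n)))).
  rewrite sumR_add; apply: eq_bigr => n _; rewrite sumR_add; apply: eq_bigr => m _.
  by rewrite (Rplus_comm (x m)) /Rdiv; ring.
rewrite [X in _ + X]exchange_big /=.
have aux (a b : R) : a = b -> a + a = 2 * b by move=> ->; ring.
by apply: aux; apply: eq_bigr => n _; rewrite sumR_scal.
Qed.

Lemma alt_harm_shift n K :
  \sum_(m < K) ((-1) ^ n * (-1) ^ m / INR (n + m).+1) = alt_harm (n + K) - alt_harm n.
Proof.
elim: K => [|K IH]; first by rewrite big_ord0 addn0; ring.
rewrite big_ord_recr IH addnS /alt_harm big_ord_recr /= pow_add; ring.
Qed.

(** alt_harm (n + c + K) is within 1/(K+1) of log 2, uniformly in n. *)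
Lemma weighted_alt_harm_lim (w : nat -> R) (W : R) c :
  (forall n, 0 <= w n) -> is_lim_seq (fun K => \sum_(n < K) w n) W ->
  is_lim_seq (fun K => \sum_(n < K) (w n * (alt_harm (n + c + K) - ln 2))) 0.
Proof.
move=> w0 HW; apply/is_lim_seq_abs_0.
apply: (is_lim_seq_le_le (fun=> 0) _ (fun K => (\sum_(n < K) w n) * / INR K.+1) 0).
- move=> K; split; first exact: Rabs_pos.
  apply: Rle_trans (sumR_abs _ _ _) _.
  rewrite Rmult_comm sumR_scal; apply: sumR_le => n _.
  rewrite Rabs_mult (Rabs_pos_eq (w n)) // Rmult_comm; apply: Rmult_le_compat_r => //.
  rewrite Rabs_minus_sym; apply: Rle_trans (alt_harm_ln2 _) _.
  by apply: Rinv_le_contravar; [exact: INR_gt0|apply: INR_leq; lia].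
- exact: is_lim_seq_const.
have := is_lim_seq_mult' _ _ _ _ HW is_lim_seq_inv_INR.
by rewrite Rmult_0_r.
Qed.

(** The alternating convolutions of beta and of eta with themselves. *)
Definition beta_conv (l : nat) : R :=
  \sum_(p < 2 * l + 1) ((-1) ^ p * beta (2 * l + 1 - p) * beta (p + 1)).
Definition eta_conv (l : nat) : R :=
  \sum_(p < 2 * l + 1) ((-1) ^ p * eta (2 * l + 1 - p) * eta (p + 1)).

Lemma beta_conv_lim l : (1 <= l)%N ->
  is_lim_seq (fun K => \sum_(n < K) (/ INR (2 * n + 1) ^ (2 * l + 1) * (ln 2 - alt_harm n)))
    (beta_conv l).
Proof.
move=> l1.
have x0 n : 0 < INR (2 * n + 1) by apply: INR_gt0; lia.
have h1 : is_lim_seq (fun K => \sum_(p < 2 * l + 1) ((-1) ^ p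
     * (\sum_(n < K) ((-1) ^ n / INR (2 * n + 1) ^ (2 * l + 1 - p)))
     * (\sum_(m < K) ((-1) ^ m / INR (2 * m + 1) ^ (p + 1))))) (beta_conv l).
  apply: is_lim_seq_sumR => p _; apply: is_lim_seq_mult'.
    by apply: is_lim_seq_scalR; apply: beta_lim; have := ltn_ord p; lia.
  by apply: beta_lim; lia.
have h2 : is_lim_seq (fun N => \sum_(n < N) / INR (2 * n + 1) ^ (2 * l + 1)) (lambda (2 * l + 1)).
  by rewrite lambdaE; [apply: lambda_lim|]; lia.
have h3 := weighted_alt_harm_lim (fun n => / INR (2 * n + 1) ^ (2 * l + 1)) _ 0
  (fun n => Rlt_le _ _ (Rinv_0_lt_compat _ (pow_lt _ (2 * l + 1) (x0 n)))) h2.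
have := is_lim_seq_minus' _ _ _ _ h1 h3; rewrite Rminus_0_r.
apply: is_lim_seq_ext => K.
rewrite (convolution_identity (fun n => (-1) ^ n) (fun n => INR (2 * n + 1))) //.
rewrite sumR_scal sumR_sub; apply: eq_bigr => n _.
rewrite [\sum_(m < K) _](_ : _ = / 2 * (alt_harm (n + K) - alt_harm n)).
  by rewrite addn0; field; apply: pow_nonzero; apply: Rgt_not_eq; exact: x0.
rewrite -alt_harm_shift sumR_scal; apply: eq_bigr => m _.
rewrite (_ : INR (2 * n + 1) + INR (2 * m + 1) = 2 * INR (n + m).+1).
  by field; apply: INR_neq0.
by rewrite S_INR (INRD n m) (INRD (2 * n)) (INRD (2 * m)) !INRM /INR; ring.
Qed.

Lemma eta_conv_lim l : (1 <= l)%N ->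
  is_lim_seq (fun K => 2 * \sum_(n < K) (/ INR n.+1 ^ (2 * l + 1) * (alt_harm n.+1 - ln 2)))
    (eta_conv l).
Proof.
move=> l1.
have x0 n : 0 < INR n.+1 by exact: INR_gt0.
have h1 : is_lim_seq (fun K => \sum_(p < 2 * l + 1) ((-1) ^ p
     * (\sum_(n < K) ((-1) ^ n / INR n.+1 ^ (2 * l + 1 - p)))
     * (\sum_(m < K) ((-1) ^ m / INR m.+1 ^ (p + 1))))) (eta_conv l).
  apply: is_lim_seq_sumR => p _; apply: is_lim_seq_mult'.
    by apply: is_lim_seq_scalR; apply: eta_lim; have := ltn_ord p; lia.
  by apply: eta_lim; lia.
have h2 : is_lim_seq (fun N => \sum_(n < N) / INR n.+1 ^ (2 * l + 1)) (zeta (2 * l + 1)).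
  by apply: zeta_lim; lia.
have h3 := is_lim_seq_scalR _ 2 _ (weighted_alt_harm_lim (fun n => / INR n.+1 ^ (2 * l + 1)) _ 1
  (fun n => Rlt_le _ _ (Rinv_0_lt_compat _ (pow_lt _ (2 * l + 1) (x0 n)))) h2).
have := is_lim_seq_plus' _ _ _ _ h1 h3; rewrite Rmult_0_r Rplus_0_r.
apply: is_lim_seq_ext => K.
rewrite (convolution_identity (fun n => (-1) ^ n) (fun n => INR n.+1)) //.
rewrite -Rmult_plus_distr_l; congr (_ * _).
rewrite sumR_add; apply: eq_bigr => n _.
rewrite [\sum_(m < K) _](_ : _ = - (alt_harm (n.+1 + K) - alt_harm n.+1)).
  by rewrite (addn1 n); ring.
rewrite -alt_harm_shift sumR_opp; apply: eq_bigr => m _.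
have -> : INR n.+1 + INR m.+1 = INR (n.+1 + m).+1 by rewrite -INRD addnS.
by rewrite [(-1) ^ n.+1]/=; field; apply: INR_neq0.
Qed.

(** * The series of harmonic type *)

(** The harmonic numbers. *)
Definition harm (k : nat) : R := \sum_(n < k) / INR n.+1.

Lemma alt_harm_double k : alt_harm (2 * k) = harm (2 * k) - harm k.
Proof.
rewrite /alt_harm /harm (sum_double (fun n => (-1) ^ n / INR n.+1)).
rewrite (sum_double (fun n => / INR n.+1)) sumR_sub; apply: eq_bigr => n _.
rewrite INR_2nS addn1 [(-1) ^ _.+1]/= pow_m1_double.
have h := INR_neq0 (ltn0Sn n); have h3 := INR_neq0 (ltn0Sn (2 * n)).
by field.
Qed.

Lemma alt_harm_double1 k : alt_harm (2 * k + 1) = harm (2 * k + 1) - harm k.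
Proof.
have h3 := INR_neq0 (ltn0Sn (2 * k)).
rewrite addn1 /alt_harm /harm !big_ord_recr /= pow_m1_double.
rewrite -/(alt_harm (2 * k)) -/(harm (2 * k)) alt_harm_double -/(harm k).
by field.
Qed.

Lemma harmS k : harm k.+1 = harm k + / INR k.+1.
Proof. by rewrite /harm big_ord_recr. Qed.

Lemma alt_harmS k : alt_harm k.+1 = alt_harm k + (-1) ^ k / INR k.+1.
Proof. by rewrite /alt_harm big_ord_recr. Qed.

Lemma cos_quot_int_even k : cos_quot_int (2 * k) = harm (2 * k) + alt_harm (2 * k).
Proof.
elim: k => [|k IH].
  by rewrite muln0 /harm /alt_harm !big_ord0 /=; ring.
rewrite mulnS add2n [LHS]/= -/cos_quot_int IH !harmS !alt_harmS.
have -> : (2 * k).+1 = (2 * k + 1)%N by rewrite addn1.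
rewrite cos_odd_PI2 addn1 [(-1) ^ _.+1]/= pow_m1_double.
have h := INR_neq0 (ltn0Sn (2 * k)); have h3 := INR_neq0 (ltn0Sn (2 * k).+1).
by field; split.
Qed.

Lemma cos_quot_int_odd k :
  cos_quot_int (2 * k + 1) = ln 2 + harm k + alt_harm k.
Proof.
elim: k => [|k IH].
  by rewrite muln0 /harm /alt_harm !big_ord0 /=; ring.
rewrite (_ : (2 * k.+1 + 1)%N = (2 * k + 1).+2); last by lia.
rewrite [LHS]/= IH harmS alt_harmS.
have h := INR_neq0 (ltn0Sn k).
have -> : INR (2 * k + 1).+1 * (PI / 2) = 0 + INR k.+1 * PI.
  by rewrite INR_2nS; field.
have -> : cos (0 + INR k.+1 * PI) = - (-1) ^ k.
  elim: k {IH h} => [|k IH]; first by rewrite /INR Rmult_1_l Rplus_0_l cos_PI /=; ring.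
  have -> : 0 + INR k.+2 * PI = (0 + INR k.+1 * PI) + PI by rewrite (S_INR k.+1); ring.
  by rewrite neg_cos IH /=; ring.
by rewrite INR_2nS; field.
Qed.

Lemma cos_quot_int_bound n : Rabs (cos_quot_int n) <= 2 * INR n.
Proof.
elim/nat_ind2: n => [||n IH].
- by rewrite /= Rabs_R0 /INR; lra.
- have := alt_harm_ln2 0; rewrite /alt_harm big_ord0 Rminus_0_r /= /INR Rinv_1; lra.
- rewrite [cos_quot_int _]/=; apply: Rle_trans (Rabs_triang _ _) _.
  have -> : INR n.+2 = INR n + 2 by rewrite !S_INR; ring.
  have n0 := INR_gt0 (ltn0Sn n); have i0 := Rinv_0_lt_compat _ n0.
  have n1 : 1 <= INR n.+1 by apply: (INR_leq (m := 1)).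
  have i1 : / INR n.+1 <= 1 by rewrite -Rinv_1; apply: Rinv_le_contravar; lra.
  have [c1 c2] := COS_bound (INR n.+1 * (PI / 2)).
  have q0 : 0 <= (1 - cos (INR n.+1 * (PI / 2))) / INR n.+1 by apply: Rmult_le_pos; lra.
  rewrite (Rabs_pos_eq (2 * _)); last by lra.
  have : (1 - cos (INR n.+1 * (PI / 2))) / INR n.+1 <= 2 * 1.
    by apply: Rmult_le_compat; lra.
  by lra.
Qed.

Lemma ex_series_over_pow (u : nat -> R) C a : (3 <= a)%N ->
  (forall n, Rabs (u n) <= C * INR n.+1) ->
  ex_series (fun n => u n / INR n.+1 ^ a).
Proof.
move=> a3 H.
apply: (@ex_series_le R_AbsRing R_CompleteNormedModule _ (fun n => C * / INR n.+1 ^ a.-1)).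
  move=> n; have n0 := INR_gt0 (ltn0Sn n).
  have p0 := pow_lt _ a n0; have p1 := pow_lt _ a.-1 n0.
  rewrite /norm /= /abs /= /Rdiv Rabs_mult (Rabs_pos_eq (/ _)); last first.
    exact/Rlt_le/Rinv_0_lt_compat.
  have -> : C * / INR n.+1 ^ a.-1 = C * INR n.+1 * / INR n.+1 ^ a.
    have -> : a = a.-1.+1 by lia.
    by rewrite /=; field; split; apply: Rgt_not_eq.
  by apply: Rmult_le_compat_r => //; exact/Rlt_le/Rinv_0_lt_compat.
apply: ex_series_scal; apply: ex_series_zeta; lia.
Qed.

Lemma zeta_bar_lim a : (3 <= a)%N ->
  is_lim_seq (fun N => \sum_(n < N) ((-1) ^ n.+1 * harm n / INR n.+1 ^ a)) (zeta_bar a 1).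
Proof.
move=> a3.
have e n : (-1) ^ n.+1 / INR n.+1 ^ a * \big[Rplus/R0]_(1 <= m < n.+1) / INR m ^ 1
   = (-1) ^ n.+1 * harm n / INR n.+1 ^ a.
  rewrite big_add1 /= big_mkord /harm.
  have -> : \sum_(i < n) / (INR i.+1 * 1) = \sum_(i < n) / INR i.+1.
    by apply: eq_bigr => i _; rewrite Rmult_1_r.
  by rewrite /Rdiv; ring.
rewrite /zeta_bar (Series_ext _ _ e); apply: Series_psum_lim.
apply: (ex_series_over_pow _ 1) => // n.
rewrite Rabs_mult pow_1_abs !Rmult_1_l Rabs_pos_eq; last first.
  by apply: sumR_ge0 => i _; apply/Rlt_le/Rinv_0_lt_compat/INR_gt0.
rewrite S_INR; have : harm n <= INR n; last by lra.
rewrite -[INR n]Rmult_1_r -sumR_const; apply: sumR_le => i _.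
rewrite -Rinv_1; apply: Rinv_le_contravar; first lra.
exact: (INR_leq (m := 1)).
Qed.

(** The series of (-1)^n [cos_quot_int] / n^a. The formulas for [cos_quot_int]
    match, for each n separately, the terms of the series on the right-hand
    side; the terms are grouped by pairs because the series of [beta_conv] runs
    over odd integers only. *)
Lemma cos_quot_series_lim l : (1 <= l)%N ->
  is_lim_seq (fun N => -2 * \sum_(n < N) ((-1) ^ n * cos_quot_int n.+1 / INR n.+1 ^ (2 * l + 1)))
    (2 * zeta_bar (2 * l + 1) 1 - 2 * eta (2 * l + 2) + 2 * beta_conv l + eta_conv l
     - 2 * ln 2 * eta (2 * l + 1)).
Proof.
move=> l1; set a := (2 * l + 1)%N; have a3 : (3 <= a)%N by rewrite /a; lia.
have ex : ex_series (fun n => (-1) ^ n * cos_quot_int n.+1 / INR n.+1 ^ a).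
  apply: (ex_series_over_pow _ 2) => // n.
  by rewrite Rabs_mult pow_1_abs Rmult_1_l; exact: cos_quot_int_bound.
have h1 := is_lim_seq_scalR _ (-2) _ (Series_psum_lim _ ex).
have h2 := is_lim_seq_double _ _ h1.
have z := is_lim_seq_scalR _ 2 _ (is_lim_seq_double _ _ (zeta_bar_lim _ a3)).
have a21 : (1 <= 2 * l + 2)%N by lia.
have a11 : (1 <= a)%N by rewrite /a; lia.
have e2 := is_lim_seq_scalR _ 2 _ (is_lim_seq_double _ _ (eta_lim _ a21)).
have e1 := is_lim_seq_scalR _ (2 * ln 2) _ (is_lim_seq_double _ _ (eta_lim _ a11)).
have b := is_lim_seq_scalR _ 2 _ (beta_conv_lim _ l1).
have y := is_lim_seq_double _ _ (eta_conv_lim _ l1).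
have h3 := is_lim_seq_minus' _ _ _ _ (is_lim_seq_plus' _ _ _ _ (is_lim_seq_plus' _ _ _ _
  (is_lim_seq_minus' _ _ _ _ z e2) b) y) e1.
suff h4 : is_lim_seq (fun N => -2 * \sum_(n < (2 * N)%N) ((-1) ^ n * cos_quot_int n.+1 / INR n.+1 ^ a))
  (2 * zeta_bar a 1 - 2 * eta (2 * l + 2) + 2 * beta_conv l + eta_conv l - 2 * ln 2 * eta a).
  by rewrite -(is_lim_seq_uniq _ _ _ h2 h4).
apply: is_lim_seq_ext h3 => K.
rewrite (sum_double (fun n => (-1) ^ n.+1 * harm n / INR n.+1 ^ a)).
rewrite (sum_double (fun n => (-1) ^ n / INR n.+1 ^ (2 * l + 2))).
rewrite (sum_double (fun n => / INR n.+1 ^ (2 * l + 1) * (alt_harm n.+1 - ln 2))).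
rewrite (sum_double (fun n => (-1) ^ n / INR n.+1 ^ a)).
rewrite (sum_double (fun n => (-1) ^ n * cos_quot_int n.+1 / INR n.+1 ^ a)).
rewrite !sumR_scal sumR_sub !sumR_add sumR_sub; apply: eq_bigr => k _.
rewrite -/a (_ : (2 * l + 2)%N = a.+1); last by rewrite /a; lia.
have -> : (2 * k + 1).+1 = (2 * k.+1)%N by lia.
rewrite (_ : (2 * k).+1 = (2 * k + 1)%N); last by rewrite addn1.
rewrite cos_quot_int_even cos_quot_int_odd alt_harm_double1.
have -> : harm (2 * k.+1) = harm (2 * k + 1) + / INR (2 * k.+1).
  by rewrite (_ : (2 * k.+1)%N = (2 * k + 1).+1) ?harmS //; lia.
have -> : harm (2 * k + 1) = harm (2 * k) + / INR (2 * k + 1) by rewrite addn1 harmS.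
have p0 := pow_m1_double k.
have p1 : (-1) ^ (2 * k + 1) = -1 by rewrite addn1 /= p0; ring.
have p2 := pow_m1_double k.+1.
rewrite p0 p1 p2.
have n1 : INR (2 * k + 1) <> 0 by apply: INR_neq0; lia.
have n2 : INR (2 * k.+1) <> 0 by apply: INR_neq0; lia.
have q1 := pow_nonzero _ a n1; have q2 := pow_nonzero _ a n2.
have powS x : x ^ a.+1 = x * x ^ a by [].
rewrite !powS.
by field; repeat split.
Qed.

Lemma fourier_int_lim l : (1 <= l)%N ->
  is_lim_seq (fourier_int l)
   (2 * zeta_bar (2 * l + 1) 1 - 2 * eta (2 * l + 2) + 2 * beta_conv l + eta_conv l
     - 2 * ln 2 * eta (2 * l + 1)
   - 4 * \sum_(i < l) (eta (2 * l - 1 - 2 * i)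
                       * (lambda (2 * i + 3) - beta_pi_sum (2 * i + 1)))).
Proof.
move=> l1.
have h2 : is_lim_seq (fun N => \sum_(i < l) ((lambda (2 * i + 3) - beta_pi_sum (2 * i + 1))
   * \sum_(n < N) ((-1) ^ n / INR n.+1 ^ (2 * l - 1 - 2 * i))))
   (\sum_(i < l) (eta (2 * l - 1 - 2 * i) * (lambda (2 * i + 3) - beta_pi_sum (2 * i + 1)))).
  apply: is_lim_seq_sumR => i _; rewrite Rmult_comm; apply: is_lim_seq_scalR.
  by apply: eta_lim; have := ltn_ord i; lia.
have h := is_lim_seq_minus' _ _ _ _ (cos_quot_series_lim _ l1) (is_lim_seq_scalR _ 4 _ h2).
apply: is_lim_seq_ext h => N.
rewrite [X in _ - _ * X](_ : _ = \sum_(n < N) \sum_(i < l)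
    ((lambda (2 * i + 3) - beta_pi_sum (2 * i + 1))
     * ((-1) ^ n / INR n.+1 ^ (2 * l - 1 - 2 * i)))).
  rewrite /fourier_int !sumR_scal sumR_sub; apply: eq_bigr => n _.
  rewrite [\sum_(i < l) _ in RHS](_ : _ = 2 * (INR n.+1 ^ (2 * l + 1) *
    \sum_(i < l) ((lambda (2 * i + 3) - beta_pi_sum (2 * i + 1))
      * (/ INR n.+1 ^ (2 * l - 1 - 2 * i))))).
    rewrite [\sum_(i < l) _ in LHS](_ : _ = (-1) ^ n *
      \sum_(i < l) ((lambda (2 * i + 3) - beta_pi_sum (2 * i + 1))
      * (/ INR n.+1 ^ (2 * l - 1 - 2 * i)))).
      by field; apply: pow_nonzero; exact: INR_neq0.
    by rewrite sumR_scal; apply: eq_bigr => i _; rewrite /Rdiv; ring.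
  rewrite !sumR_scal; apply: eq_bigr => i _.
  rewrite beta_pi_sum_odd.
  have f0 := INR_neq0 (fact_gt0 (2 * i.+1)); have n0 := INR_neq0 (ltn0Sn n).
  have pn k : INR n.+1 ^ k <> 0 by apply: pow_nonzero.
  have -> : INR n.+1 ^ (2 * l + 1) = INR n.+1 ^ (2 * i.+1) * INR n.+1 ^ (2 * l - 1 - 2 * i).
    by rewrite -pow_add; congr (_ ^ _); have := ltn_ord i; rewrite plusE; lia.
  have s : (-1) ^ i.+1 * (-1) ^ i.+1 = 1 by rewrite pow_m1E; case: odd; ring.
  transitivity (((-1) ^ i.+1 * (-1) ^ i.+1) * (2 * (INR n.+1 ^ (2 * i.+1) *
     (lambda (2 * i + 3) - beta_pi_sum (2 * i + 1))))).
    by field.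
  by rewrite s; field.
rewrite exchange_big; apply: eq_bigr => i _; exact: sumR_scal.
Qed.

(** Evaluation of S in which [psi_moment] is already expressed by beta and
    lambda; the theorem follows by rearranging finite sums. *)
Lemma S_bar2_onesE l : (1 <= l)%N ->
  S_bar2_ones l =
     2 * zeta_bar (2 * l + 1) 1 - 2 * eta (2 * l + 2) + 2 * beta_conv l + eta_conv l
     - 2 * ln 2 * eta (2 * l + 1)
   - 4 * \sum_(i < l) (eta (2 * l - 1 - 2 * i)
                       * (lambda (2 * i + 3) - beta_pi_sum (2 * i + 1))).
Proof. by case: l => // l l1; apply: S_bar2_ones_lim; exact: fourier_int_lim. Qed.

(** * Finite sums over indices with a prescribed sum *)

Lemma sum_singleton N c (P : bool) (F : nat -> R) : (c < N)%N ->
  \sum_(r < N | P && (r == c :> nat)) F r = if P then F c else 0.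
Proof.
move=> cN; case: P => /=; last by rewrite big_pred0.
by rewrite (big_pred1 (Ordinal cN)).
Qed.

Lemma sum_antidiagonal2 N M (F : nat -> nat -> R) : (M < N)%N ->
  \sum_(r < N) \sum_(k < N | (r + 2 * k == M)%N) F r k
  = \sum_(k < M./2.+1) F (M - 2 * k)%N k.
Proof.
move=> MN; rewrite (exchange_big_dep xpredT) //=.
have le : (M./2.+1 <= N)%N by lia.
rewrite (big_ord_widen N (fun k => F (M - 2 * k)%N k)) // [RHS]big_mkcond.
apply: eq_bigr => k _.
rewrite -(sum_singleton N (M - 2 * k)%N _ (fun r => F r k)); last by lia.
by apply: eq_bigl => r; apply/idP/idP; lia.
Qed.

Lemma sum_antidiagonal N M (F : nat -> nat -> R) : (M < N)%N ->
  \sum_(p < N) \sum_(r < N | (p + r == M)%N) F p r = \sum_(p < M.+1) F p (M - p)%N.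
Proof.
move=> MN; rewrite (big_ord_widen N (fun p => F p (M - p)%N)) // [RHS]big_mkcond.
apply: eq_bigr => p _.
rewrite -(sum_singleton N (M - p)%N _ (F p)); last by lia.
by apply: eq_bigl => r; apply/idP/idP; lia.
Qed.

Lemma powerRZ_2_sub p : powerRZ 2 (1 - Z.of_nat p) = 2 * / 2 ^ p.
Proof.
by rewrite /Z.sub powerRZ_add ?powerRZ_neg' -?pow_powerRZ ?powerRZ_1 //; lra.
Qed.

Lemma beta_pi_sum_double_sum N M c : (M < N)%N ->
  \sum_(r < N) \sum_(k < N | (r + 2 * k == M)%N)
    (c * (beta (r + 1) * ((-1) ^ k / INR (2 * k + 1)`!) * (PI / 2) ^ (2 * k + 1)))
  = c * beta_pi_sum M.
Proof.
move=> MN.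
rewrite (sum_antidiagonal2 N M (fun r k =>
  c * (beta (r + 1) * ((-1) ^ k / INR (2 * k + 1)`!) * (PI / 2) ^ (2 * k + 1)))) //.
rewrite /beta_pi_sum sumR_scal; apply: eq_bigr => k _.
have -> : (M + 1 - 2 * k)%N = (M - 2 * k + 1)%N by have := ltn_ord k; lia.
by rewrite /Rdiv; ring.
Qed.

(** The terms of even index of the right-hand side vanish by
    [beta_pi_sum_even]. *)
Lemma eta_lambda_odd_part l :
  \sum_(i < l) (eta (2 * l + 1 - 2 * i) * (lambda (2 * i + 3) - beta_pi_sum (2 * i + 1)))
  = \sum_(i < (2 * l).+1) ((-1) ^ i.+1 * eta (i + 2)
      * (lambda (2 * l - i + 2) - beta_pi_sum (2 * l - i))).
Proof.
have e0 := beta_pi_sum_even 0; rewrite muln0 in e0.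
rewrite big_ord_recr /= subnn e0 (Rminus_diag_eq (lambda _)) // Rmult_0_r Rplus_0_r.
rewrite (sum_double (fun i => (-1) ^ i.+1 * eta (i + 2)
      * (lambda (2 * l - i + 2) - beta_pi_sum (2 * l - i)))).
rewrite (reindex_inj rev_ord_inj); apply: eq_bigr => k _ /=.
have kl := ltn_ord k.
rewrite (_ : (2 * l - 2 * k)%N = (2 * (l - k))%N); last by lia.
have -> : lambda (2 * (l - k) + 2) - beta_pi_sum (2 * (l - k)) = 0.
  by rewrite beta_pi_sum_even; ring.
rewrite Rmult_0_r Rplus_0_l.
have -> : (2 * l + 1 - 2 * (l - k.+1) = 2 * k + 1 + 2)%N by lia.
have -> : (2 * (l - k.+1) + 3 = 2 * l - (2 * k + 1) + 2)%N by lia.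
have -> : (2 * (l - k.+1) + 1 = 2 * l - (2 * k + 1))%N by lia.
have -> : (-1) ^ (2 * k + 1) = -1 by rewrite addn1 /= pow_m1_double; ring.
by ring.
Qed.

(** The two extreme terms of the convolution involve eta 1 = log 2. *)
Lemma eta_conv_ends l : eta_conv l.+1 = 2 * ln 2 * eta (2 * l + 3)
  + \sum_(i < (2 * l).+1) ((-1) ^ i.+1 * eta (i + 2) * eta (2 * l - i + 2)).
Proof.
rewrite /eta_conv (_ : (2 * l.+1 + 1)%N = (2 * l).+3); last by lia.
rewrite big_ord_recl big_ord_recr /= add0n subn0 eta1.
rewrite (_ : bump 0 (2 * l).+1 = (2 * l).+2) //.
rewrite (_ : ((2 * l).+3 - (2 * l).+2)%N = 1%N); last by lia.
rewrite eta1 pow_m1_double (_ : ((2 * l).+2 + 1)%N = (2 * l + 3)%N); last by lia.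
rewrite (_ : (2 * l).+3 = (2 * l + 3)%N); last by lia.
rewrite [X in _ + (X + _)](_ : _ = \sum_(i < (2 * l).+1)
  ((-1) ^ i.+1 * eta (i + 2) * eta (2 * l - i + 2))).
  by move: (\sum_(i < (2 * l).+1) _) => s; rewrite /=; ring.
apply: eq_bigr => i _; rewrite /bump /= add1n.
rewrite (_ : (2 * l + 3 - i.+1)%N = (2 * l - i + 2)%N); last by have := ltn_ord i; lia.
rewrite (_ : (i.+1 + 1)%N = (i + 2)%N); last by lia.
by rewrite add0n; ring.
Qed.

Lemma zeta_conv_double_sum l :
  \sum_(p < (2 * l + 3)%N)
     \sum_(q < (2 * l + 3)%N | [&& p + q == 2 * l + 2, 2 <= p & 2 <= q]%N)
       ((-1) ^ p * (1 - powerRZ 2 (1 - Z.of_nat p))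
       * (3 - powerRZ 2 (1 - Z.of_nat q)) * zeta p * zeta q)
  = \sum_(2 <= p < (2 * l).+1)
      ((-1) ^ p * eta p * ((3 - 2 * / 2 ^ (2 * l + 2 - p)) * zeta (2 * l + 2 - p))).
Proof.
transitivity (\sum_(p < (2 * l + 3)%N) if (2 <= p <= 2 * l)%N then
   ((-1) ^ p * eta p * ((3 - 2 * / 2 ^ (2 * l + 2 - p)) * zeta (2 * l + 2 - p))) else 0).
  apply: eq_bigr => p _.
  rewrite (eq_bigl (fun q : 'I__ => (2 <= p <= 2 * l)%N && (q == (2 * l + 2 - p)%N :> nat))); last first.
    by move=> q; apply/idP/idP; lia.
  have [p2|p2] := boolP (2 <= p <= 2 * l)%N; last by rewrite big_pred0.
  rewrite (sum_singleton _ _ true (fun q => (-1) ^ p * (1 - powerRZ 2 (1 - Z.of_nat p))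
       * (3 - powerRZ 2 (1 - Z.of_nat q)) * zeta p * zeta q)) /=; last by lia.
  rewrite !powerRZ_2_sub etaE; last by lia.
  by ring.
rewrite -big_mkcond /= -(big_mkord (fun p => 2 <= p <= 2 * l)%N
  (fun p => (-1) ^ p * eta p * ((3 - 2 * / 2 ^ (2 * l + 2 - p)) * zeta (2 * l + 2 - p)))).
rewrite (big_nat_widen 2 _ (2 * l + 3)) ; last by lia.
rewrite (big_nat_widenl 2 0) //.
by apply: eq_bigl => p; apply/idP/idP; lia.
Qed.

Lemma beta_conv_double_sum l :
  \sum_(p < (2 * l + 1)%N) \sum_(r < (2 * l + 1)%N | (p + r == 2 * l)%N)
     (2 * (-1) ^ p * beta (r + 1) * beta (p + 1)) = 2 * beta_conv l.
Proof.
rewrite (sum_antidiagonal _ _ (fun p r => 2 * (-1) ^ p * beta (r + 1) * beta (p + 1))); last by lia.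
rewrite /beta_conv -addn1 sumR_scal; apply: eq_bigr => p _.
rewrite (_ : (2 * l + 1 - p)%N = (2 * l - p + 1)%N); last by have := ltn_ord p; lia.
by ring.
Qed.

Lemma eta_beta_triple_sum l :
  \sum_(p < (2 * l.+1)%N) \sum_(r < (2 * l.+1)%N)
       \sum_(k < (2 * l.+1)%N | [&& p + r + 2 * k == 2 * l.+1 - 1 & 1 <= p]%N)
         (4 * (-1) ^ (p + k) * beta (r + 1) * (1 - / 2 ^ p) * zeta (p + 1)
         * / INR (2 * k + 1)`! * (PI / 2) ^ (2 * k + 1))
  = 4 * \sum_(i < (2 * l).+1) ((-1) ^ i.+1 * eta (i + 2) * beta_pi_sum (2 * l - i)).
Proof.
rewrite (_ : (2 * l.+1)%N = (2 * l).+2); last by lia.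
rewrite big_ord_recl big1 => [|r _]; last first.
  by rewrite big_pred0 // => k; rewrite andbF.
rewrite Rplus_0_l sumR_scal; apply: eq_bigr => i _.
rewrite lift0.
transitivity (\sum_(r < (2 * l).+2) \sum_(k < (2 * l).+2 | (r + 2 * k == 2 * l - i)%N)
  (4 * (-1) ^ i.+1 * eta (i + 2) *
   (beta (r + 1) * ((-1) ^ k / INR (2 * k + 1)`!) * (PI / 2) ^ (2 * k + 1)))).
  apply: eq_bigr => r _; apply: eq_big => [k|k _].
    by move: (ltn_ord i) => ?; apply/idP/idP; lia.
  rewrite pow_add etaE; last by lia.
  rewrite (_ : (i.+1 + 1)%N = (i + 2)%N); last by lia.
  have p0 : 2 ^ i.+1 <> 0 by apply: pow_nonzero; lra.
  have -> : 2 * / 2 ^ (i + 2) = / 2 ^ i.+1.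
    rewrite (_ : (i + 2)%N = i.+2); last by lia.
    by rewrite [2 ^ i.+2]/= -/(2 ^ i.+1); field.
  have f0 := INR_neq0 (fact_gt0 (2 * k + 1)).
  by field; split.
by rewrite beta_pi_sum_double_sum; [ring|lia].
Qed.

(** The coefficient (3 - 2^(1-q)) zeta q is 4 lambda q - eta q. *)
Lemma zeta_conv_shift l :
  \sum_(2 <= p < (2 * l.+1).+1)
      ((-1) ^ p * eta p * ((3 - 2 * / 2 ^ (2 * l.+1 + 2 - p)) * zeta (2 * l.+1 + 2 - p)))
  = \sum_(i < (2 * l).+1) ((-1) ^ i.+1 * eta (i + 2)
      * (eta (2 * l - i + 2) - 4 * lambda (2 * l - i + 2))).
Proof.
rewrite (_ : (2 * l.+1).+1 = (2 * l).+3); last by lia.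
rewrite big_add1 /= big_add1 /= big_mkord; apply: eq_bigr => i _.
have il := ltn_ord i.
rewrite (_ : (2 * l.+1 + 2 - i.+2)%N = (2 * l - i + 2)%N); last by lia.
rewrite (_ : (i + 2)%N = i.+2); last by lia.
rewrite (etaE (2 * l - i + 2)) ?lambdaE; try lia.
by rewrite /=; ring.
Qed.

Theorem corollary20 (l : nat) (hl : (1 <= l)%N) :
  S_bar2_ones l =
    2 * zeta_bar (2 * l + 1) 1
    + powerRZ 2 (-1 - 2 * Z.of_nat l) * zeta (2 * l + 2)
    + (powerRZ 2 (1 - 2 * Z.of_nat l) - 4) * ln 2 * zeta (2 * l + 1)
    + (\sum_(r < (2 * l)%N) \sum_(k < (2 * l)%N | (r + 2 * k == 2 * l - 1)%N)
         4 * ln 2 * beta (r + 1)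
         * ((-1) ^ k / INR (2 * k + 1)`!) * (PI / 2) ^ (2 * k + 1))
    + (\sum_(p < (2 * l + 3)%N)
       \sum_(q < (2 * l + 3)%N | [&& p + q == 2 * l + 2, 2 <= p & 2 <= q]%N)
         (-1) ^ p * (1 - powerRZ 2 (1 - Z.of_nat p))
         * (3 - powerRZ 2 (1 - Z.of_nat q)) * zeta p * zeta q)
    + (\sum_(r < (2 * l + 1)%N) \sum_(k < (2 * l + 1)%N | (r + 2 * k == 2 * l)%N)
         2 * beta (r + 1)
         * ((-1) ^ (k + 1) / INR (2 * k + 1)`!) * (PI / 2) ^ (2 * k + 1))
    + (\sum_(p < (2 * l + 1)%N) \sum_(r < (2 * l + 1)%N | (p + r == 2 * l)%N)
         2 * (-1) ^ p * beta (r + 1) * beta (p + 1))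
    + (\sum_(p < (2 * l)%N) \sum_(r < (2 * l)%N)
       \sum_(k < (2 * l)%N | [&& p + r + 2 * k == 2 * l - 1 & 1 <= p]%N)
         4 * (-1) ^ (p + k) * beta (r + 1) * (1 - / 2 ^ p) * zeta (p + 1)
         * / INR (2 * k + 1)`! * (PI / 2) ^ (2 * k + 1)).
Proof.
rewrite S_bar2_onesE // zeta_conv_double_sum beta_conv_double_sum.
case: l hl => [//|l _].
rewrite eta_beta_triple_sum zeta_conv_shift eta_conv_ends.
have -> : \sum_(r < (2 * l.+1)%N) \sum_(k < (2 * l.+1)%N | (r + 2 * k == 2 * l.+1 - 1)%N)
         (4 * ln 2 * beta (r + 1)
         * ((-1) ^ k / INR (2 * k + 1)`!) * (PI / 2) ^ (2 * k + 1))
   = 4 * ln 2 * beta_pi_sum (2 * l + 1).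
  have -> : (2 * l + 1 = 2 * l.+1 - 1)%N by lia.
  rewrite -(beta_pi_sum_double_sum (2 * l.+1)); last by lia.
  by apply: eq_bigr => r _; apply: eq_bigr => k _; ring.
have -> : \sum_(r < (2 * l.+1 + 1)%N) \sum_(k < (2 * l.+1 + 1)%N | (r + 2 * k == 2 * l.+1)%N)
         (2 * beta (r + 1)
         * ((-1) ^ (k + 1) / INR (2 * k + 1)`!) * (PI / 2) ^ (2 * k + 1))
   = - 2 * lambda (2 * l.+1 + 2).
  rewrite -beta_pi_sum_even -(beta_pi_sum_double_sum (2 * l.+1 + 1)); last by lia.
  by apply: eq_bigr => r _; apply: eq_bigr => k _; rewrite pow_add /Rdiv /=; ring.
have pS k : 2 ^ k.+1 = 2 * 2 ^ k by [].
have p2 k : 2 ^ k <> 0 by apply: pow_nonzero; lra.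
have -> : powerRZ 2 (-1 - 2 * Z.of_nat l.+1) = / 2 ^ (2 * l.+1 + 1).
  rewrite (_ : (-1 - 2 * Z.of_nat l.+1 = - Z.of_nat (2 * l.+1 + 1))%Z); last by lia.
  by rewrite powerRZ_neg' -pow_powerRZ.
have -> : powerRZ 2 (1 - 2 * Z.of_nat l.+1) = 2 * / 2 ^ (2 * l.+1).
  rewrite (_ : (1 - 2 * Z.of_nat l.+1 = 1 - Z.of_nat (2 * l.+1))%Z); last by lia.
  exact: powerRZ_2_sub.
have e1 : - 2 * eta (2 * l.+1 + 2)
    = / 2 ^ (2 * l.+1 + 1) * zeta (2 * l.+1 + 2) - 2 * lambda (2 * l.+1 + 2).
  rewrite etaE ?lambdaE; try lia.
  rewrite (_ : (2 * l.+1 + 2)%N = (2 * l.+1 + 1).+1); last by lia.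
  by rewrite pS; move: (2 ^ (2 * l.+1 + 1)) (p2 (2 * l.+1 + 1)%N) => t t0; field.
have e2 : (2 * / 2 ^ (2 * l.+1) - 4) * ln 2 * zeta (2 * l.+1 + 1)
    = - 4 * ln 2 * lambda (2 * l.+1 + 1).
  rewrite lambdaE; last by lia.
  by rewrite addn1 pS; move: (2 ^ (2 * l.+1)) (p2 (2 * l.+1)%N) => t t0; field.
have e3 : \sum_(i < l.+1) (eta (2 * l.+1 - 1 - 2 * i)
    * (lambda (2 * i + 3) - beta_pi_sum (2 * i + 1)))
  = \sum_(i < (2 * l).+1) ((-1) ^ i.+1 * eta (i + 2)
      * (lambda (2 * l - i + 2) - beta_pi_sum (2 * l - i)))
    + ln 2 * (lambda (2 * l.+1 + 1) - beta_pi_sum (2 * l + 1)).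
  rewrite big_ord_recr -eta_lambda_odd_part; congr (_ + _).
    by apply: eq_bigr => i _ /=; rewrite (_ : (2 * l.+1 - 1)%N = (2 * l + 1)%N) //; lia.
  rewrite /= (_ : (2 * l.+1 - 1 - 2 * l)%N = 1%N); last by lia.
  by rewrite eta1 (_ : (2 * l.+1 + 1)%N = (2 * l + 3)%N) //; lia.
(* lambda q - U_(q-2) with q = 2l-i+2 absorbs the 4 lambda q of
   [zeta_conv_shift]. *)
have e4 : \sum_(i < (2 * l).+1) ((-1) ^ i.+1 * eta (i + 2)
      * (eta (2 * l - i + 2) - 4 * lambda (2 * l - i + 2)))
    + 4 * \sum_(i < (2 * l).+1) ((-1) ^ i.+1 * eta (i + 2) * beta_pi_sum (2 * l - i))
  = \sum_(i < (2 * l).+1) ((-1) ^ i.+1 * eta (i + 2) * eta (2 * l - i + 2))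
    - 4 * \sum_(i < (2 * l).+1) ((-1) ^ i.+1 * eta (i + 2)
      * (lambda (2 * l - i + 2) - beta_pi_sum (2 * l - i))).
  by rewrite !sumR_scal sumR_add sumR_sub; apply: eq_bigr => i _; ring.
have e5 : eta (2 * l + 3) = eta (2 * l.+1 + 1) by congr eta; lia.
rewrite e2 e3 e5.
move: e1 e4; lra.
Qed.
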